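(* Let $\varphi\in\Phi$ and let $f\in L^{\psi^+}(\Omega)$, where $\psi^-,\psi^+$ are the left and right derivatives of $\varphi$. Then there exists a polynomial $P\in\Pi^m$ such that, for all $Q\in\Pi^m$, $$\int_{\{f>P\}\cap\{Q<0\}}\psi^-(|f-P|)|Q|\,dx+\int_{\{f<P\}\cap\{Q>0\}}\psi^-(|f-P|)|Q|\,dx\leqslant\int_{\{f<P\}\cap\{Q<0\}}\psi^+(|f-P|)|Q|\,dx+\int_{\{f>P\}\cap\{Q>0\}}\psi^+(|f-P|)|Q|\,dx .$$ In addition, it holds that $$\int_\Omega\varphi(|P|)\,dx\leqslant5\Lambda_{\psi^+}\|P\|_\infty\int_\Omega\psi^+(|f|)\,dx .$$
   Context: $\Omega$ is a bounded Lebesgue measurable subset of $\mathbb{R}^n$; $\int_A f$ means $\int_{\Omega\cap A}f\,dx$ with Lebesgue measure. $\mathcal S$ is the set of non-decreasing functions $\psi:[0,\infty)\to[0,\infty)$ with $\psi(0)=0$, $\psi(s)>0$ for $s>0$, $\psi(s)\to0$ as $s\to0^+$ and $\psi(s)\to\infty$ as $s\to\infty$. A function $\psi$ satisfies the $\Delta_2$ condition if there is a constant $\Lambda_\psi>0$ with $\psi(2s)\leqslant\Lambda_\psi\psi(s)$ for all $s\ge0$. $\Phi$ is the class of functions $\varphi(s)=\int_0^s\psi(r)\,dr$ on $[0,\infty)$, with $\psi\in\mathcal S$, that satisfy the $\Delta_2$ condition. $\psi^-,\psi^+$ denote the left and right derivatives of $\varphi$, with $\psi^-(0)=0$ by convention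 (and $\psi^+(0)=0$); both satisfy the $\Delta_2$ condition, and $\Lambda_{\psi^+}$ is a $\Delta_2$ constant of $\psi^+$. $L^{\psi^+}(\Omega)$ is the class of real-valued Lebesgue measurable $f$ on $\Omega$ with $\int_\Omega\psi^+(|f|)\,dx<\infty$. $\Pi^m$ is the space of real algebraic polynomials on $\mathbb{R}^n$ of degree at most $m$, and $\|P\|_\infty=\sup_{x\in\Omega}|P(x)|$. *)

(* Defs.v *)
From HB Require Import structures.
From mathcomp Require Import all_boot all_order all_algebra.
From mathcomp Require Import -(notations) mpoly.
From mathcomp Require Import all_classical all_reals all_analysis.

Set Implicit Arguments.
Unset Strict Implicit.
Unset Printing Implicit Defensive.

Import Order.TTheory GRing.Theory Num.Theory.
Import numFieldNormedType.Exports.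

Local Open Scope classical_set_scope.
Local Open Scope ring_scope.

(* Lebesgue measure on R^d, d = n.+1 >= 1: Caratheodory's construction from the
   Lebesgue outer measure. The measurable sets of the resulting measurable type
   are exactly the Lebesgue (not only Borel) measurable sets. *)
Section lebesgue_outer_measure.
Context (R : realType) (n : nat).
Local Notation Rn := 'rV[R]_n.+1.

Definition box (c : Rn * Rn) : set Rn :=
  [set x | forall i, c.1 ord0 i < x ord0 i <= c.2 ord0 i].

Definition box_volume (c : Rn * Rn) : R :=
  \prod_(i < n.+1) Num.max 0 (c.2 ord0 i - c.1 ord0 i).

Definition box_cover (A : set Rn) : set (nat -> Rn * Rn) :=
  [set c | A `<=` \bigcup_k box (c k)].

Definition lebesgue_outer (A : set Rn) : \bar R :=
  ereal_inf [set (\sum_(k <oo) (box_volume (c k))%:E)%E | c in box_cover A].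

Local Lemma box_volume_ge0 c : 0 <= box_volume c.
Proof. by apply: prodr_ge0 => i _; rewrite le_max lexx. Qed.

Local Open Scope ereal_scope.

Local Lemma lebesgue_outer_ge0 A : 0 <= lebesgue_outer A.
Proof.
apply: le_ereal_inf_tmp => _ [c _ <-].
by apply: nneseries_ge0 => k _ _; rewrite lee_fin box_volume_ge0.
Qed.

Local Lemma lebesgue_outer0 : lebesgue_outer set0 = 0.
Proof.
apply/eqP; rewrite eq_le lebesgue_outer_ge0 andbT.
apply: ereal_inf_lbound; exists (fun=> (0%R, 0%R)); first by move=> ? [].
apply: eseries0 => k _ _.
by rewrite /box_volume big_ord_recl /= subrr maxxx mul0r.
Qed.

Local Lemma le_lebesgue_outer : {homo lebesgue_outer : A B / A `<=` B >-> A <= B}.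
Proof.
move=> A B AB; apply/ereal_inf_le_tmp => _ [c cB <-].
by exists c => //; exact: subset_trans AB cB.
Qed.

Local Lemma lebesgue_outer_sigma_subadditive : sigma_subadditive lebesgue_outer.
Proof.
move=> A; have [[i ioo]|] := pselect (exists i, lebesgue_outer (A i) = +oo).
  rewrite (eseries_pinfty _ _ ioo) ?leey// => k _.
  by rewrite -ltNye (lt_le_trans _ (lebesgue_outer_ge0 _)).
rewrite -forallNE => Aoo.
suff add2e (e : {posnum R}) : lebesgue_outer (\bigcup_k A k) <=
    \sum_(i <oo) lebesgue_outer (A i) + e%:num%:E.
  by apply/lee_addgt0Pr => _/posnumP[].
rewrite (le_trans _ (epsilon_trick _ _ _))//; last first.
  by move=> k; exact: lebesgue_outer_ge0.
pose V (c : Rn * Rn) : \bar R := (box_volume c)%:E.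
have V0 c : 0 <= V c by rewrite lee_fin box_volume_ge0.
pose P k c := box_cover (A k) c /\
  \sum_(j <oo) V (c j) <= lebesgue_outer (A k) + (e%:num / (2 ^ k.+1)%:R)%:E.
have [G PG] : {G : nat -> nat -> Rn * Rn & forall k, P k (G k)}.
  apply: (@choice _ _ P) => k.
  have e0 : (0 < e%:num / (2 ^ k.+1)%:R :> R)%R by [].
  have fin : lebesgue_outer (A k) \is a fin_num.
    by rewrite ge0_fin_numE ?lebesgue_outer_ge0// ltey; apply/eqP/Aoo.
  have [_ [c cA <-] lt] := lb_ereal_inf_adherent e0 fin.
  by exists c; split => //; exact: ltW.
have /card_esym/ppcard_eqP[h] := card_nat2.
apply: (@le_trans _ _ (\esum_(i in setT) V (uncurry G i))).
  apply: ereal_inf_lbound => /=; exists (uncurry G \o h).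
    move=> t [k _ /(PG k).1[j _ tGkj]].
    by exists (h^-1%FUN (k, j)) => //=; rewrite invK ?inE.
  rewrite -(esum_pred_image (V \o uncurry G) h xpredT) ?[fun=> _]set_true//;
    last by move=> *; exact: V0.
  by rewrite image_eq.
rewrite (_ : esum _ _ = \sum_(i <oo) \sum_(j <oo) V (G i j)); last first.
  pose J k : set (nat * nat) := [set (k, j) | j in setT].
  rewrite (_ : setT = \bigcup_k J k); last first.
    by rewrite predeqE => -[a b]; split => // _; exists a => //; exists b.
  rewrite esum_bigcupT /=; last 2 first.
    - apply/trivIsetP => i j _ _ ij.
      rewrite predeqE => -[k l] /=; split => //= -[] [_] _ [<-{k} _].
      by move=> [l' _] [] /esym/eqP; rewrite (negbTE ij).
    - by move=> ?; exact: V0.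
  rewrite -(image_id [set: nat]) -fun_true esum_pred_image//; last first.
    by move=> k _; apply: esum_ge0 => ? _; exact: V0.
  apply: eq_eseriesr => /= j _.
  rewrite -(esum_pred_image (V \o uncurry G) (pair j) predT)//=; last first.
    by move=> ? ? _ _; exact: (@can_inj _ _ _ snd).
  by congr esum; rewrite predeqE => -[a b]; split; move=> [i _ <-]; exists i.
apply: lee_nneseries => k *; last by have [] := PG k.
by apply: nneseries_ge0 => *; exact: V0.
Qed.

HB.instance Definition _ := isOuterMeasure.Build R Rn lebesgue_outer
  lebesgue_outer0 lebesgue_outer_ge0 le_lebesgue_outer
  lebesgue_outer_sigma_subadditive.

End lebesgue_outer_measure.

Definition lebesgue_Rn_type (R : realType) (n : nat) :=
  caratheodory_type (@lebesgue_outer R n).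

HB.instance Definition _ (R : realType) (n : nat) :=
  Measurable.on (lebesgue_Rn_type R n).

Definition lebesgue_Rn (R : realType) (n : nat) :
  set (lebesgue_Rn_type R n) -> \bar R := @lebesgue_outer R n.
Arguments lebesgue_Rn : clear implicits.

HB.instance Definition _ (R : realType) (n : nat) :=
  let mu : {outer_measure set 'rV[R]_n.+1 -> \bar R} := @lebesgue_outer R n in
  isMeasure.Build _ (lebesgue_Rn_type R n) R (lebesgue_Rn R n)
    (@caratheodory_measure0 _ _ mu) (@caratheodory_measure_ge0 _ _ mu)
    (@caratheodory_measure_sigma_additive _ _ mu).

(* Functions on [0, oo[ are encoded as functions R -> R of which only the values
   on [0, oo[ matter. *)
Section orlicz.
Context (R : realType).
Implicit Types psi phi : R -> R.

Definition class_S psi : Prop :=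
  [/\ forall s, 0 <= s -> 0 <= psi s,
      forall s t, 0 <= s -> s <= t -> psi s <= psi t,
      psi 0 = 0,
      forall s, 0 < s -> 0 < psi s
    & psi s @[s --> 0^'+] --> (0 : R) /\ psi s @[s --> +oo] --> +oo].

Definition Delta2_constant psi (Lambda : R) : Prop :=
  0 < Lambda /\ forall s, 0 <= s -> psi (2 * s) <= Lambda * psi s.

Definition Delta2 psi : Prop := exists Lambda, Delta2_constant psi Lambda.

Definition class_Phi phi : Prop :=
  (exists2 psi, class_S psi &
     forall s, 0 <= s -> phi s = \int[lebesgue_measure]_(r in `[0, s]) psi r) /\
  Delta2 phi.

Definition psi_plus phi (s : R) : R :=
  lim (h^-1 * (phi (s + h) - phi s) @[h --> 0^'+]).

Definition psi_minus phi (s : R) : R :=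
  if s == 0 then 0 else lim (h^-1 * (phi (s + h) - phi s) @[h --> 0^'-]).

Definition class_L n psi (Omega : set (lebesgue_Rn_type R n))
    (f : lebesgue_Rn_type R n -> R) : Prop :=
  measurable_fun Omega f /\
  (\int[lebesgue_Rn R n]_(x in Omega) (psi `|f x|)%:E < +oo)%E.

End orlicz.

Section polynomials.
Context (R : realType) (n : nat).

Definition poly_le (m : nat) (P : mpoly n.+1 R) : Prop :=
  (msize P <= m.+1)%N.

Definition peval (P : mpoly n.+1 R) (x : 'rV[R]_n.+1) : R :=
  meval (fun i => x ord0 i) P.

Definition sup_norm (Omega : set 'rV[R]_n.+1) (P : mpoly n.+1 R) : R :=
  sup [set `|peval P x| | x in Omega].

End polynomials.

(* Main.v *)
(* Idea.  Since only [psi_plus phi |f|] is integrable, one minimizes over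
   polynomials [P] of degree at most [m] the difference
     J P = \int_Omega (phi |f - P| - phi |f|),
   which is finite because, by convexity and Delta_2, the integrand is bounded
   by a multiple of [psi_plus phi |f| + 1].  J is locally Lipschitz in the
   coefficients, and it is coercive modulo the polynomials vanishing a.e. on
   Omega: [phi] grows superlinearly on [{|f| <= M}] and, by convexity, the part
   of the integral over [{|f| > M}] is at least
   [- ||P|| * \int_{|f| > M} psi_plus phi |f|], a small multiple of [- ||P||]
   for large [M].  Dominated convergence applied to the difference quotients of
   [t |-> J (P - t Q)] at [0+] gives the one-sided variational inequality.
   Taking [Q = P] in it controls [\int phi |P|] over [{2 |f| < |P|}], where
   [f - P] and [P] have opposite signs and [phi |P| <= |P| psi_plus (2 (|P|/2))
   <= Lambda |P| psi_minus |f - P|]; elsewhere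
   [phi |P| <= |P| psi_plus (2 |f|) <= Lambda |P| psi_plus |f|].  This proves the
   bound with [2] in place of [5]. *)
Require Import Defs.
From mathcomp Require Import all_boot all_order all_algebra.
From mathcomp Require Import -(notations) mpoly.
From mathcomp Require Import ring lra.
From mathcomp Require Import all_classical all_reals all_analysis.
From mathcomp Require Import measurable_realfun.

Import Order.TTheory GRing.Theory Num.Theory.
Import numFieldNormedType.Exports.

Local Open Scope classical_set_scope.
Local Open Scope ring_scope.

(** * One-sided derivatives of a convex function *)

Section young_function.
Context {R : realType} {psi phi : R -> R}.
Hypothesis psiS : class_S psi.
Hypothesis phiE : forall s, 0 <= s ->
  phi s = \int[lebesgue_measure]_(r in `[0, s]) psi r.

Let psi_ge0 s : 0 <= s -> 0 <= psi s. Proof. by case: psiS => + _ _ _ _; exact. Qed.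
Let psi_nd s t : 0 <= s -> s <= t -> psi s <= psi t.
Proof. by case: psiS => _ + _ _ _; exact. Qed.

(** [psi] is arbitrary on negative reals, so measurability is drawn from [psi (Num.max 0 r)], which
    is non-decreasing on the whole line and agrees with [psi] on the interval. *)
Lemma class_S_integrable b :
  (@lebesgue_measure R).-integrable `[0, b] (EFin \o psi).
Proof.
have mpsi : measurable_fun [set: R] (fun r => psi (Num.max 0 r)).
  apply: nondecreasing_measurable => // s t st.
  by apply: psi_nd; rewrite ?ge_max !le_max ?lexx ?st ?orbT.
have mpsib : measurable_fun (`[0, b] : set R) psi.
  refine (eq_measurable_fun (fun r : R => psi (Num.max 0 r)) _ _).
    by move=> r; rewrite inE/= in_itv/= => /andP[r0 _]; rewrite max_r.
  exact: measurable_funTS.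
apply: measurable_bounded_integrable => //.
- by rewrite /= lebesgue_measure_itv/=; case: ifP => // _; rewrite -EFinD ltry.
- exists (psi b); split; first exact: num_real.
  move=> M bM r /=; rewrite in_itv/= => /andP[r0 rb].
  by rewrite ger0_norm ?psi_ge0// (le_trans _ (ltW bM))// psi_nd.
Qed.

(** The increment is the integral of the monotone [psi] over []a, b]], where [psi] lies between its
    endpoint values. This estimate plays the role of convexity in what follows. *)
Lemma young_increment_bounds a b : 0 <= a -> a <= b ->
  (b - a) * psi a <= phi b - phi a <= (b - a) * psi b.
Proof.
move=> a0 ab; rewrite (phiE a)// (phiE b) ?(le_trans a0)//.
have mu_ab : fine (@lebesgue_measure R `]a, b]) = b - a.
  rewrite /= lebesgue_measure_itv/= lte_fin; case: ltP => //= ba.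
  by apply/eqP; rewrite eq_sym subr_eq0 eq_le ab ba.
have iab : (@lebesgue_measure R).-integrable `]a, b] (EFin \o psi).
  apply: integrableS (class_S_integrable b) => //.
  by apply: subset_itvr; rewrite bnd_simp.
have ic c : (@lebesgue_measure R).-integrable `]a, b] (EFin \o cst c).
  apply: measurable_bounded_integrable => //.
    by rewrite /= lebesgue_measure_itv/=; case: ifP => // _; rewrite -EFinD ltry.
  exists `|c|; split; first exact: num_real.
  by move=> M cM r _; exact: ltW.
rewrite Rintegral_itvB ?bnd_simp//; last exact: class_S_integrable.
apply/andP; split.
- rewrite -mu_ab mulrC -Rintegral_cst//; apply: le_Rintegral => //; first exact: ic.
  by move=> r /=; rewrite in_itv/= => /andP[ar rb]; rewrite psi_nd// ltW.
- rewrite -mu_ab mulrC -Rintegral_cst//; apply: le_Rintegral => //; first exact: ic.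
  by move=> r /=; rewrite in_itv/= => /andP[ar rb]; rewrite psi_nd// (le_trans a0)// ltW.
Qed.

Lemma young0 : phi 0 = 0.
Proof. by rewrite phiE// set_itv1 Rintegral_set1. Qed.

Lemma young_nd a b : 0 <= a -> a <= b -> phi a <= phi b.
Proof.
move=> a0 ab; have /andP[h _] := young_increment_bounds _ _ a0 ab.
rewrite -subr_ge0; apply: le_trans h.
by rewrite mulr_ge0 ?subr_ge0// psi_ge0.
Qed.

Lemma young_ge0 a : 0 <= a -> 0 <= phi a.
Proof. by move=> a0; rewrite -young0 young_nd. Qed.

Let slope s h := h^-1 * (phi (s + h) - phi s).

Lemma young_slope_right s h : 0 <= s -> 0 < h -> psi s <= slope s h <= psi (s + h).
Proof.
move=> s0 h0; have sh : s <= s + h by rewrite lerDl ltW.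
have := young_increment_bounds _ _ s0 sh.
by rewrite [s + h]addrC addrK /slope ler_pdivlMl// ler_pdivrMl// addrC.
Qed.

Lemma young_slope_left s h : 0 <= s + h -> h < 0 -> psi (s + h) <= slope s h <= psi s.
Proof.
move=> s0 h0; have sh : s + h <= s by lra.
have := young_increment_bounds _ _ s0 sh.
have -> : s - (s + h) = - h by ring.
rewrite /slope -[h^-1 * _]mulrNN -invrN opprB.
by rewrite ler_pdivlMl ?oppr_gt0// ler_pdivrMl ?oppr_gt0.
Qed.

(** The slope over [[s, s + h]] is at most [psi (s + h)], and the increment over [[s + h, s + k]] is
    at least [k - h] times that value, so lengthening the step cannot lower the slope. *)
Lemma young_slope_right_nd s h k : 0 <= s -> 0 < h -> h <= k -> slope s h <= slope s k.
Proof.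
move=> s0 h0 hk; have k0 : 0 < k by exact: lt_le_trans hk.
have /andP[_ u] := young_slope_right _ _ s0 h0.
have sh0 : 0 <= s + h by rewrite addr_ge0// ltW.
have shk : s + h <= s + k by rewrite lerD2l.
have /andP[l _] := young_increment_bounds _ _ sh0 shk.
rewrite [leRHS]/slope ler_pdivlMl//.
have e : phi (s + h) - phi s = h * slope s h.
  by rewrite /slope mulVKf// gt_eqF.
have e2 : (k - h) * slope s h <= (k - h) * psi (s + h).
  by rewrite ler_wpM2l// subr_ge0.
by rewrite (_ : s + k - (s + h) = k - h) in l; [lra|ring].
Qed.

Lemma young_slope_left_nd s h k : 0 <= s + h -> h <= k -> k < 0 -> slope s h <= slope s k.
Proof.
move=> sh0 hk k0; have h0 : h < 0 by exact: le_lt_trans k0.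
have shk : s + h <= s + k by rewrite lerD2l.
have sk0 : 0 <= s + k by exact: le_trans shk.
have /andP[u _] := young_slope_left _ _ sk0 k0.
have /andP[_ l] := young_increment_bounds _ _ sh0 shk.
have e : phi (s + k) - phi s = k * slope s k.
  by rewrite /slope mulVKf// lt_eqF.
have e2 : (k - h) * psi (s + k) <= (k - h) * slope s k.
  by rewrite ler_wpM2l// subr_ge0.
rewrite [leLHS]/slope -[h^-1 * _]mulrNN -invrN opprB ler_pdivrMl ?oppr_gt0//.
by rewrite (_ : s + k - (s + h) = k - h) in l; [lra|ring].
Qed.

(** [psi_plus] is a bare [lim], informative only once convergence is known; right slopes are
    monotone in the step and bounded below by [psi s]. *)
Lemma psi_plus_cvg s : 0 <= s -> slope s h @[h --> 0^'+] --> psi_plus phi s.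
Proof.
move=> s0; apply: nondecreasing_at_right_is_cvgr.
- near=> x => h k; rewrite !in_itv/= => /andP[h0 _] _ hk.
  exact: young_slope_right_nd.
- near=> x; exists (psi s) => _ [h + <-]; rewrite /= in_itv/= => /andP[h0 _].
  by have /andP[] := young_slope_right _ _ s0 h0.
Unshelve. all: by end_near. Qed.

Lemma psi_minus_cvg s : 0 < s -> slope s h @[h --> 0^'-] --> psi_minus phi s.
Proof.
move=> s0; rewrite /psi_minus gt_eqF//; apply: nondecreasing_at_left_is_cvgr.
- near=> x.
  (* Steps shorter than [s] keep [s + h] in the half-line where [phiE] applies. *)
  have sx : - s < x by near: x; apply: nbhs_left_gt; rewrite oppr_lt0.
  move=> h k; rewrite !in_itv/= => /andP[xh _] /andP[_ k0] hk.
  by apply: young_slope_left_nd => //; lra.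
- near=> x.
  have sx : - s < x by near: x; apply: nbhs_left_gt; rewrite oppr_lt0.
  exists (psi s) => _ [h + <-]; rewrite /= in_itv/= => /andP[xh h0].
  have sh : 0 <= s + h by lra.
  by have /andP[] := young_slope_left _ _ sh h0.
Unshelve. all: by end_near. Qed.

Lemma psi_plus_ge s : 0 <= s -> psi s <= psi_plus phi s.
Proof.
move=> s0; apply: (cvgr_to_ge (psi_plus_cvg _ s0)); near=> h.
have h0 : 0 < h by [].
by have /andP[] := young_slope_right _ _ s0 h0.
Unshelve. all: by end_near. Qed.

Lemma psi_plus_le_increment s t : 0 <= s -> s <= t ->
  (t - s) * psi_plus phi s <= phi t - phi s.
Proof.
move=> s0; rewrite le_eqVlt => /predU1P[->|st]; first by rewrite !subrr mul0r.
have ts : 0 < t - s by rewrite subr_gt0.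
rewrite -ler_pdivlMl// (_ : phi t = phi (s + (t - s))); last by congr phi; ring.
apply: (cvgr_to_le (psi_plus_cvg _ s0)); near=> h.
apply: young_slope_right_nd => //.
by near: h; exact: nbhs_right_le.
Unshelve. all: by end_near. Qed.

Lemma psi_plus_le s t : 0 <= s -> s < t -> psi_plus phi s <= psi t.
Proof.
move=> s0 st; have ts : 0 < t - s by rewrite subr_gt0.
have := psi_plus_le_increment _ _ s0 (ltW st).
rewrite -ler_pdivlMl// => /le_trans; apply.
have := young_slope_right _ _ s0 ts; rewrite /slope (_ : s + (t - s) = t); last ring.
by case/andP.
Qed.

Lemma psi_minus_le s : 0 < s -> psi_minus phi s <= psi s.
Proof.
move=> s0; apply: (cvgr_to_le (psi_minus_cvg _ s0)); near=> h.
have hs : - s < h by near: h; apply: nbhs_left_gt; rewrite oppr_lt0.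
have h0 : h < 0 by [].
have sh : 0 <= s + h by lra.
by have /andP[] := young_slope_left _ _ sh h0.
Unshelve. all: by end_near. Qed.

(** The value of [psi] at the midpoint separates the two sides: it bounds the right derivative at
    [s] from above and all sufficiently short left slopes at [t] from below. *)
Lemma psi_plus_le_minus s t : 0 <= s -> s < t -> psi_plus phi s <= psi_minus phi t.
Proof.
move=> s0 st; pose u := (s + t) / 2.
have su : s < u by rewrite midf_lt.
have ut : u < t by rewrite midf_lt.
apply: (le_trans (psi_plus_le _ _ s0 su)).
apply: (cvgr_to_ge (psi_minus_cvg _ (le_lt_trans s0 st))); near=> h.
have hu : - (t - u) < h by near: h; apply: nbhs_left_gt; rewrite oppr_lt0 subr_gt0.
have h0 : h < 0 by [].
have th : u <= t + h by lra.
have th0 : 0 <= t + h by rewrite (le_trans s0)// (le_trans (ltW su)).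
have /andP[+ _] := young_slope_left _ _ th0 h0; apply: le_trans.
by apply: psi_nd => //; rewrite (le_trans s0)// ltW.
Unshelve. all: by end_near. Qed.

Lemma psi_plus_ge0 s : 0 <= s -> 0 <= psi_plus phi s.
Proof. by move=> s0; rewrite (le_trans _ (psi_plus_ge _ s0))// psi_ge0. Qed.

(** The bound [psi_plus phi 0 <= psi h] for [h > 0] passes to the limit because [psi] tends to 0 at
    the origin. *)
Lemma psi_plus0 : psi_plus phi 0 = 0.
Proof.
apply/eqP; rewrite eq_le psi_plus_ge0// andbT.
case: psiS => _ _ _ _ [c0 _]; apply: (cvgr_to_ge c0); near=> h.
exact: psi_plus_le.
Unshelve. all: by end_near. Qed.

Lemma psi_plus_nd s t : 0 <= s -> s <= t -> psi_plus phi s <= psi_plus phi t.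
Proof.
move=> s0; rewrite le_eqVlt => /predU1P[->//|st].
by rewrite (le_trans (psi_plus_le _ _ s0 st))// psi_plus_ge// (le_trans s0)// ltW.
Qed.

Lemma psi_minus_le_plus s : 0 <= s -> psi_minus phi s <= psi_plus phi s.
Proof.
rewrite le_eqVlt => /predU1P[<-|s0]; first by rewrite /psi_minus eqxx psi_plus0.
by rewrite (le_trans (psi_minus_le _ s0))// psi_plus_ge// ltW.
Qed.

Lemma psi_minus_ge0 s : 0 <= s -> 0 <= psi_minus phi s.
Proof.
rewrite le_eqVlt => /predU1P[<-|s0]; first by rewrite /psi_minus eqxx.
by rewrite -psi_plus0 psi_plus_le_minus.
Qed.

Lemma psi_minus_nd s t : 0 <= s -> s <= t -> psi_minus phi s <= psi_minus phi t.
Proof.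
move=> s0; rewrite le_eqVlt => /predU1P[->//|st].
by rewrite (le_trans (psi_minus_le_plus _ s0))// psi_plus_le_minus.
Qed.

Lemma young_increment_le_psi_plus s t : 0 <= s -> s <= t ->
  phi t - phi s <= (t - s) * psi_plus phi t.
Proof.
move=> s0 st; have /andP[_] := young_increment_bounds _ _ s0 st.
move/le_trans; apply; rewrite ler_wpM2l ?subr_ge0// psi_plus_ge//.
exact: le_trans st.
Qed.

(** Since [psi] is unbounded, it exceeds [|A|] from some [N] on, so [phi] grows there with slope at
    least [|A|]; the constant [|A| * N] pays for the interval [[0, N]]. *)
Lemma young_superlinear A : exists B, forall s, 0 <= s -> A * s <= phi s + B.
Proof.
case: psiS => _ _ _ _ [_ /cvgryPge/(_ `|A|)[M [_ psiM]]].
pose N := `|M| + 1; have N0 : 0 <= N by rewrite addr_ge0.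
have psiN : `|A| <= psi N by apply: psiM; rewrite /N ltr_pwDr// ler_norm.
exists (`|A| * N) => s s0.
have As : A * s <= `|A| * s by rewrite ler_wpM2r// ler_norm.
have [sN|Ns] := leP s N.
  have := young_ge0 _ s0; have : `|A| * s <= `|A| * N by rewrite ler_wpM2l.
  by lra.
have /andP[+ _] := young_increment_bounds _ _ N0 (ltW Ns).
have := young_ge0 _ N0.
have : (s - N) * `|A| <= (s - N) * psi N by rewrite ler_wpM2l// subr_ge0 ltW.
by lra.
Qed.

(** With [L] a doubling constant of [phi], the chain is [2 s psi_plus (2 s) <= phi (4 s) <= L^2 phi
    s <= L^2 s psi_plus s], then division by [s]. *)
Lemma psi_plus_Delta2 : Delta2 phi -> Delta2 (psi_plus phi).
Proof.
move=> [L [L0 Lphi]]; exists (L ^+ 2); split; first by rewrite exprn_gt0.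
move=> s; rewrite le_eqVlt => /predU1P[<-|s0].
  by rewrite mulr0 psi_plus0 mulr0.
have s20 : 0 <= 2 * s by lra.
have s24 : 2 * s <= 2 * (2 * s) by lra.
have e1 := psi_plus_le_increment _ _ s20 s24.
have e2 := young_increment_le_psi_plus _ _ (lexx 0) (ltW s0).
have e3 := Lphi _ s20.
have e4 : L * phi (2 * s) <= L * (L * phi s) by rewrite ler_wpM2l ?Lphi// ltW.
have e5 := young_ge0 _ s20.
have e6 : L * (L * phi s) <= L * (L * (s * psi_plus phi s)).
  do 2 (rewrite ler_wpM2l//; try exact: ltW).
  by rewrite young0 !subr0 in e2.
rewrite -(ler_pM2l s0).
have e7 : 0 <= s * psi_plus phi (2 * s) by rewrite mulr_ge0 ?psi_plus_ge0// ltW.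
by lra.
Qed.

End young_function.

(** * The modular difference *)

Lemma measurable_comp_normr {d} {T : measurableType d} {R : realType} (D : set T)
    (g : R -> R) (h : T -> R) :
  (forall s t, 0 <= s -> s <= t -> g s <= g t) ->
  measurable_fun D h -> measurable_fun D (fun x => g `|h x|).
Proof.
move=> gnd mh.
have mg : measurable_fun [set: R] (fun r => g (Num.max 0 r)).
  apply: nondecreasing_measurable => // s t st.
  by apply: gnd; rewrite ?ge_max !le_max ?lexx ?st ?orbT.
have -> : (fun x => g `|h x|) = (fun r => g (Num.max 0 r)) \o (fun x => `|h x|).
  by apply/funext => x /=; rewrite max_r.
by apply: measurableT_comp => //; exact: measurableT_comp.
Qed.

Definition bounded_measurable {d} {T : measurableType d} {R : realType}
    (D : set T) (u : T -> R) : Prop :=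
  measurable_fun D u /\ exists C, forall x, D x -> `|u x| <= C.

Definition modular_diff {d} {T : measurableType d} {R : realType}
    (mu : {measure set T -> \bar R}) (D : set T) (phi : R -> R) (f u : T -> R) : R :=
  \int[mu]_(x in D) (phi `|f x - u x| - phi `|f x|).

Section modular_difference.
Context {d} {T : measurableType d} {R : realType} {mu : {measure set T -> \bar R}}.
Context {Om : set T}.
Hypothesis mOm : measurable Om.
Hypothesis muOm : (mu Om < +oo)%E.
Context {psi phi : R -> R}.
Hypothesis psiS : class_S psi.
Hypothesis phiE : forall s, 0 <= s ->
  phi s = \int[lebesgue_measure]_(r in `[0, s]) psi r.
Hypothesis phiD : Delta2 phi.
Context {f : T -> R}.
Hypothesis mf : measurable_fun Om f.
Hypothesis fint : (\int[mu]_(x in Om) (psi_plus phi `|f x|)%:E < +oo)%E.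

Local Notation p := (psi_plus phi).
Local Notation J := (modular_diff mu Om phi f).
Implicit Types (a b c C D : R) (u v : T -> R) (x : T).

Let pge0 := psi_plus_ge0 psiS phiE.
Let pnd := psi_plus_nd psiS phiE.
Let pge0N (r : R) : 0 <= p `|r|. Proof. exact: pge0. Qed.

(** [a + b] is at most twice the larger of the two, so the doubling constant serves as [L]. *)
Lemma psi_plus_shift_le b : 0 <= b ->
  exists2 L, 0 < L & forall a, 0 <= a -> p (a + b) <= L * (p a + p b).
Proof.
move=> b0; have [L [L0 pL]] := psi_plus_Delta2 psiS phiE phiD.
exists L => // a a0; have [ab|ba] := leP a b.
  apply: (@le_trans _ _ (p (2 * b))); first by apply: pnd; [exact: addr_ge0|lra].
  by rewrite (le_trans (pL _ b0))// ler_wpM2l ?(ltW L0)// lerDr pge0.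
apply: (@le_trans _ _ (p (2 * a))); first by apply: pnd; [exact: addr_ge0|lra].
by rewrite (le_trans (pL _ a0))// ler_wpM2l ?(ltW L0)// lerDl pge0.
Qed.

(** A mean value estimate: [p c] dominates every slope of [phi] on [[0, c]], and the absolute value
    is 1-Lipschitz. *)
Lemma young_norm_lipschitz a b c : `|a| <= c -> `|b| <= c ->
  `|phi `|a| - phi `|b| | <= `|a - b| * p c.
Proof.
wlog ba : a b / `|b| <= `|a|.
  move=> h ac bc; have [ba|/ltW ab] := leP `|b| `|a|; first exact: h.
  by rewrite distrC [`|a - b|]distrC h.
move=> ac bc; rewrite ger0_norm; last first.
  by rewrite subr_ge0; exact: (young_nd psiS phiE).
apply: (le_trans (young_increment_le_psi_plus psiS phiE _ _ (normr_ge0 b) ba)).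
apply: ler_pM => //; rewrite ?subr_ge0 ?pge0//.
  exact: lerB_dist.
exact: pnd.
Qed.

Lemma measurable_psi_plus_norm (E : set T) (h : T -> R) :
  measurable_fun E h -> measurable_fun E (fun x => p `|h x|).
Proof. by apply: measurable_comp_normr => s t; exact: pnd. Qed.

Lemma measurable_psi_minus_norm (E : set T) (h : T -> R) :
  measurable_fun E h -> measurable_fun E (fun x => psi_minus phi `|h x|).
Proof.
by apply: measurable_comp_normr => s t; exact: (psi_minus_nd psiS phiE).
Qed.

Lemma measurable_young_norm (E : set T) (h : T -> R) :
  measurable_fun E h -> measurable_fun E (fun x => phi `|h x|).
Proof. by apply: measurable_comp_normr => s t; exact: (young_nd psiS phiE). Qed.

Lemma integrable_bounded (h : T -> R) c : measurable_fun Om h ->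
  (forall x, Om x -> `|h x| <= c) -> mu.-integrable Om (EFin \o h).
Proof.
move=> mh hc; apply: measurable_bounded_integrable => //.
exists c; split; first exact: num_real.
by move=> M cM x /= Omx; rewrite (le_trans _ (ltW cM))// hc.
Qed.

Lemma integrable_psi_plus : mu.-integrable Om (fun x => (p `|f x|)%:E).
Proof.
apply/integrableP; split.
  by apply/measurable_EFinP; exact: measurable_psi_plus_norm.
under eq_integral do rewrite gee0_abs ?lee_fin ?pge0N//.
exact: fint.
Qed.

Lemma integrable_psi_plus_shift c : 0 <= c ->
  mu.-integrable Om (fun x => (p (`|f x| + c))%:E).
Proof.
move=> c0; have [L L0 pL] := psi_plus_shift_le c c0.
apply: (@le_integrable _ _ _ _ _ mOm _ (fun x => (L * (p `|f x| + p c))%:E)).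
- apply/measurable_EFinP.
  have -> : (fun x => p (`|f x| + c)) = (fun x => p `| (`|f x| + c) |).
    by apply/funext => x; rewrite [X in _ = p X]ger0_norm// addr_ge0.
  apply: measurable_psi_plus_norm; apply: measurable_funD => //.
  exact: measurableT_comp.
- move=> x _; rewrite lee_fin ger0_norm ?pge0 ?addr_ge0//.
  by rewrite (le_trans (pL _ _))// ler_norm.
- under eq_fun do rewrite EFinM EFinD.
  apply: integrableZl => //; apply: integrableD => //.
    exact: integrable_psi_plus.
  by apply: (integrable_bounded (cst (p c)) `|p c|).
Qed.

(** This pointwise majorant gives both the Lipschitz bound on [J] and the domination of its
    difference quotients; it is integrable by the shift lemma. *)
Lemma young_diff_bound u v C D x : `|u x| <= C -> `|v x| <= C ->
  `|u x - v x| <= D ->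
  `|phi `|f x - u x| - phi `|f x - v x| | <= D * p (`|f x| + C).
Proof.
move=> uC vC uvD; have C0 : 0 <= C by exact: le_trans uC.
have fC w : `|w| <= C -> `|f x - w| <= `|f x| + C.
  by move=> wC; rewrite (le_trans (ler_normB _ _))// lerD2l.
rewrite (le_trans (young_norm_lipschitz _ _ _ (fC _ uC) (fC _ vC)))//.
rewrite ler_wpM2r ?pge0 ?addr_ge0// (le_trans _ uvD)//.
by rewrite distrC (_ : f x - v x - (f x - u x) = u x - v x)//; ring.
Qed.

Lemma integrable_young_diff u v : bounded_measurable Om u -> bounded_measurable Om v ->
  mu.-integrable Om (fun x => (phi `|f x - u x| - phi `|f x - v x|)%:E).
Proof.
move=> [mu' [C uC]] [mv [D vD]]; pose M := `|C| + `|D|.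
have M0 : 0 <= M by rewrite addr_ge0.
have uM x : Om x -> `|u x| <= M.
  by move=> /uC uC'; rewrite /M; have := ler_norm C; have := normr_ge0 D; lra.
have vM x : Om x -> `|v x| <= M.
  by move=> /vD vD'; rewrite /M; have := ler_norm D; have := normr_ge0 C; lra.
apply: (@le_integrable _ _ _ _ _ mOm _ (fun x => (2 * M)%:E * (p (`|f x| + M))%:E)%E).
- apply/measurable_EFinP; apply: measurable_funB; apply: measurable_young_norm;
    exact: measurable_funB.
- move=> x Omx; rewrite -EFinM lee_fin (le_trans _ (ler_norm _))//.
  apply: young_diff_bound; [exact: uM|exact: vM|].
  by rewrite (le_trans (ler_normB _ _))// mulr_natl mulr2n lerD ?uM ?vM.
- by apply: integrableZl => //; exact: integrable_psi_plus_shift.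
Qed.

(** The terms [phi |f|] cancel; linearity is legitimate because each difference is integrable, as
    the comparison with the zero function shows. *)
Lemma modular_diffB u v : bounded_measurable Om u -> bounded_measurable Om v ->
  J u - J v = \int[mu]_(x in Om) (phi `|f x - u x| - phi `|f x - v x|).
Proof.
move=> bu bv.
have b0 : bounded_measurable Om (cst (0 : R)) by split=> //; exists 0 => x _; rewrite normr0.
have i0 w : bounded_measurable Om w ->
    mu.-integrable Om (fun x => (phi `|f x - w x| - phi `|f x|)%:E).
  move=> bw; have := integrable_young_diff _ _ bw b0.
  by under eq_fun do rewrite subr0.
rewrite /J -RintegralB//; [|exact: i0..].
by apply: eq_Rintegral => x _; ring.
Qed.

Lemma modular_diff_lipschitz u v C D : bounded_measurable Om u -> bounded_measurable Om v ->
  0 <= C ->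
  (forall x, Om x -> `|u x| <= C) -> (forall x, Om x -> `|v x| <= C) ->
  (forall x, Om x -> `|u x - v x| <= D) ->
  `|J u - J v| <= D * \int[mu]_(x in Om) p (`|f x| + C).
Proof.
move=> bu bv C0 uC vC uvD; rewrite modular_diffB//.
have i1 := integrable_young_diff _ _ bu bv.
have i2 := integrable_psi_plus_shift C C0.
rewrite (le_trans (le_normr_Rintegral _ _))// -RintegralZl//.
apply: le_Rintegral => //.
- rewrite (_ : _ \o _ = abse \o (fun x => (phi `|f x - u x| - phi `|f x - v x|)%:E)).
    exact: integrable_abse.
  by apply/funext.
- rewrite (_ : _ \o _ = (fun x => D%:E * (p (`|f x| + C))%:E)%E).
    exact: integrableZl.
  by apply/funext => x; rewrite -EFinM.
- by move=> x Omx; apply: young_diff_bound; [exact: uC|exact: vC|exact: uvD].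
Qed.

Lemma modular_diff_ae u v : bounded_measurable Om u -> bounded_measurable Om v ->
  \int[mu]_(x in Om) `|u x - v x| = 0 -> J u = J v.
Proof.
move=> bu bv uv0; apply/eqP; rewrite -subr_eq0 modular_diffB//; apply/eqP.
have muv : measurable_fun Om (fun x => u x - v x).
  by apply: measurable_funB; [case: bu|case: bv].
have iuv : mu.-integrable Om (fun x => (u x - v x)%:E).
  case: bu => _ [C uC]; case: bv => _ [D vD].
  apply: (integrable_bounded _ (C + D)) => // x Omx.
  by rewrite (le_trans (ler_normB _ _))// lerD ?uC ?vD.
have /ae_eq_integral_abs : (\int[mu]_(x in Om) `|(u x - v x)%:E|)%E = 0%E.
  rewrite -[LHS]fineK; last by apply: integrable_fin_num => //; exact: integrable_abse.
  by congr EFin; rewrite -[RHS]uv0.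
move=> /(_ mOm); case; first exact/measurable_EFinP.
move=> N [mN N0 uvN]; rewrite /Rintegral.
rewrite (@ae_eq_integral _ _ _ mu Om (cst 0%E)) ?integral0//.
  by apply: measurable_int (integrable_young_diff _ _ bu bv).
exists N; split => //; apply: subset_trans uvN => x; apply: contra_not => h Omx.
have [] := h Omx; move/eqP; rewrite subr_eq0 => /eqP ->.
by rewrite subrr.
Qed.

End modular_difference.

(** * Coercivity *)

Lemma locally_lipschitz_continuous {R : realType} {N : nat} (g : 'rV[R]_N -> R) :
  (forall c, exists2 K, 0 <= K &
     forall c', `|c - c'| <= 1 -> `|g c - g c'| <= K * `|c - c'|) ->
  continuous g.
Proof.
move=> lip c; have [K K0 gK] := lip c.
(* [K + 1] replaces [K] so that the radius [e / (K + 1)] makes sense when [K = 0]. *)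
apply/(@cvgrPdist_lt _ _ _ (nbhs c)) => e e0; have K1 : 0 < K + 1 by exact: ltr_wpDl.
apply/(@nbhs_normP R 'rV[R]_N c); exists (Num.min 1 (e / (K + 1))) => /=.
  by rewrite lt_min ltr01 divr_gt0.
move=> c' /=; rewrite lt_min => /andP[/ltW c1 cd].
apply: (le_lt_trans (gK _ c1)); move: cd; rewrite ltr_pdivlMr//.
by apply: le_lt_trans; rewrite mulrC ler_wpM2l// lerDl.
Qed.

Definition lincomb {T : Type} {R : pzRingType} {N : nat} (e : 'I_N -> T -> R)
  (c : 'rV[R]_N) (x : T) : R := \sum_i c ord0 i * e i x.

Section best_approximation.
Context {d} {T : measurableType d} {R : realType} {mu : {measure set T -> \bar R}}.
Context {Om : set T}.
Hypothesis mOm : measurable Om.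
Hypothesis muOm : (mu Om < +oo)%E.
Context {psi phi : R -> R}.
Hypothesis psiS : class_S psi.
Hypothesis phiE : forall s, 0 <= s ->
  phi s = \int[lebesgue_measure]_(r in `[0, s]) psi r.
Hypothesis phiD : Delta2 phi.
Context {f : T -> R}.
Hypothesis mf : measurable_fun Om f.
Hypothesis fint : (\int[mu]_(x in Om) (psi_plus phi `|f x|)%:E < +oo)%E.

Local Notation p := (psi_plus phi).
Local Notation J := (modular_diff mu Om phi f).
Implicit Types (C D : R) (u v : T -> R) (x : T).

Let pge0 := psi_plus_ge0 psiS phiE.
Let pnd := psi_plus_nd psiS phiE.

Lemma integrable_norm_bounded u : bounded_measurable Om u ->
  mu.-integrable Om (EFin \o (fun x => `|u x|)).
Proof.
move=> [mu_u [C uC]]; apply: (integrable_bounded mOm muOm _ C) => [|x Omx].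
  exact: measurableT_comp.
by rewrite normr_id uC.
Qed.

(** Dominated convergence along integer thresholds: at each point the truncated integrand vanishes
    as soon as the threshold passes [|f x|]. *)
Lemma psi_plus_tail_small A e : 0 < e ->
  exists2 M : R, 0 <= M &
    \int[mu]_(x in Om) (if M < `|f x| then A + p `|f x| else 0) <= e.
Proof.
move=> e0.
pose g x : R := A + p `|f x|.
have mg : measurable_fun Om g.
  by apply: measurable_funD => //; exact: (measurable_psi_plus_norm psiS phiE).
have ig : mu.-integrable Om (EFin \o g).
  rewrite (_ : _ \o _ = (fun x => A%:E + (p `|f x|)%:E)%E).
    apply: integrableD => //; last exact: (integrable_psi_plus psiS phiE).
    by apply: (integrable_bounded mOm muOm (cst A) `|A|).
  by apply/funext => x; rewrite -EFinD.
pose h n x : \bar R := (if n%:R < `|f x| then g x else 0)%:E.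
have mh n : measurable_fun Om (h n).
  apply/measurable_EFinP.
  apply: measurable_fun_if => //; first by apply: measurable_fun_ltr => //; exact: measurableT_comp.
  exact: measurable_funS mg.
have h0 : {ae mu, forall x, Om x -> h ^~ x @ \oo --> cst 0%E x}.
  apply: aeW => x _; apply: cvg_near_cst; near=> n.
  rewrite /h ltNge (_ : `|f x| <= n%:R)//.
  by near: n; exact: nbhs_infty_ger.
have hg : {ae mu, forall x n, Om x -> (`|h n x| <= `|(g x)%:E|)%E}.
  by apply: aeW => x n _; rewrite /h; case: ifP => // _; rewrite abse0.
have [_ _] := dominated_convergence mOm mh (measurable_cst 0%E) h0 (integrable_abse ig) hg.
rewrite integral0 => /fine_cvgP[_ /cvgrPdist_le/(_ e e0)[n _ /(_ n (leqnn n))]].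
rewrite /= sub0r normrN => hn; exists n%:R => //.
exact: le_trans (ler_norm _) hn.
Unshelve. all: by end_near. Qed.

Lemma integrable_psi_plus_tail A M :
  mu.-integrable Om (EFin \o (fun x => if M < `|f x| then A + p `|f x| else 0)).
Proof.
apply: (@le_integrable _ _ _ _ _ mOm _ (fun x => `|A|%:E + (p `|f x|)%:E)%E).
- apply/measurable_EFinP; apply: measurable_fun_if => //.
    by apply: measurable_fun_ltr => //; exact: measurableT_comp.
  apply: (@measurable_funS _ _ _ _ Om) => //.
  by apply: measurable_funD => //; exact: (measurable_psi_plus_norm psiS phiE).
- move=> x Omx; rewrite /= lee_fin.
  rewrite [leRHS]ger0_norm ?addr_ge0 ?pge0//; case: ifP => _.
    by rewrite (le_trans (ler_normD _ _))// lerD2l ger0_norm ?pge0.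
  by rewrite normr0 addr_ge0 ?pge0.
- apply: integrableD => //; last exact: (integrable_psi_plus psiS phiE).
  by apply: (integrable_bounded mOm muOm (cst `|A|) `|A|) => // x _; rewrite normr_id.
Qed.

(** Where [|f| <= M], superlinearity gives [phi |f - u| >= A |u| - A M - B]. Where [|f| > M],
    convexity limits the decrease to [|u| p |f|], and the summand [A] in the tail integrand
    compensates the term [A |u|] claimed there too. [K] must not depend on [u] or [C]. *)
Lemma modular_diff_lower A M : 0 <= A -> 0 <= M ->
  exists K, forall u C, bounded_measurable Om u -> (forall x, Om x -> `|u x| <= C) ->
    A * \int[mu]_(x in Om) `|u x| - K -
      C * \int[mu]_(x in Om) (if M < `|f x| then A + p `|f x| else 0) <= J u.
Proof.
move=> A0 M0; have [B phiB] := young_superlinear psiS phiE A.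
have B0 : 0 <= B.
  by have := phiB 0 (lexx _); rewrite mulr0 (young0 phiE) add0r.
(* The terms pay respectively for replacing [|f - u|] by [|u|], for superlinearity, and for
   [phi |f|], all where [|f| <= M]. *)
pose K0 := A * M + B + phi M.
have pM0 : 0 <= phi M by exact: (young_ge0 psiS phiE).
exists (K0 * fine (mu Om)) => u C bu uC.
have it := integrable_psi_plus_tail A M.
have iu := integrable_norm_bounded _ bu.
have iK : mu.-integrable Om (EFin \o cst K0).
  by apply: (integrable_bounded mOm muOm (cst K0) `|K0|).
have i1 : mu.-integrable Om (EFin \o (fun x => A * `|u x|)).
  by rewrite (_ : _ \o _ = (fun x => A%:E * (`|u x|)%:E)%E); [exact: integrableZl|apply/funext].
have i2 : mu.-integrable Om (EFin \o (fun x => A * `|u x| - K0)).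
  by rewrite (_ : _ \o _ = (fun x => (A * `|u x|)%:E - K0%:E)%E); [exact: integrableB|apply/funext].
have i3 : mu.-integrable Om (EFin \o (fun x => C * (if M < `|f x| then A + p `|f x| else 0))).
  by rewrite (_ : _ \o _ = (fun x => C%:E * (if M < `|f x| then A + p `|f x| else 0)%:E)%E);
    [exact: integrableZl|apply/funext].
rewrite -!RintegralZl// -Rintegral_cst// -!RintegralB//.
have b0 : bounded_measurable Om (cst (0 : R)) by split=> //; exists 0 => x _; rewrite normr0.
apply: le_Rintegral => //.
- by rewrite (_ : _ \o _ = (fun x => (A * `|u x| - K0)%:E -
    (C * (if M < `|f x| then A + p `|f x| else 0))%:E)%E); [exact: integrableB|apply/funext].
- have := integrable_young_diff mOm muOm psiS phiE phiD mf fint _ _ bu b0.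
  by under eq_fun do rewrite subr0.
move=> x Omx; have uCx := uC _ Omx.
have fu0 := normr_ge0 (f x - u x); have u0 := normr_ge0 (u x).
have pf0 : 0 <= phi `|f x - u x| by exact: (young_ge0 psiS phiE).
have AM : 0 <= A * M by exact: mulr_ge0.
case: ltP => fM.
- have Au : A * `|u x| <= C * A by rewrite mulrC ler_wpM2r.
  have pu : `|u x| * p `|f x| <= C * p `|f x| by rewrite ler_wpM2r ?pge0.
  suff : phi `|f x| - phi `|f x - u x| <= `|u x| * p `|f x| by rewrite /K0; lra.
  have [ffu|/ltW fuf] := leP `|f x| `|f x - u x|.
    have : phi `|f x| <= phi `|f x - u x| by exact: (young_nd psiS phiE).
    have : 0 <= `|u x| * p `|f x| by rewrite mulr_ge0 ?pge0.
    by lra.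
  apply: (le_trans (young_increment_le_psi_plus psiS phiE _ _ fu0 fuf)).
  rewrite ler_wpM2r ?pge0//; apply: (le_trans (lerB_dist _ _)).
  by rewrite opprB addrC subrK.
- have pfM : phi `|f x| <= phi M by exact: (young_nd psiS phiE).
  have := phiB _ fu0.
  have : A * `|u x| <= A * (`|f x - u x| + M).
    rewrite ler_wpM2l//; apply: le_trans (lerD (lexx _) fM).
    rewrite -{1}(subKr (f x) (u x)) (le_trans (ler_normB _ _))// addrC //.
  by rewrite mulr0 /K0; lra.
Qed.

(** Slope [2 / c0] makes the main term at least [2 r]; a tail integral below [1 / (C1 + 1)] costs at
    most [r]. *)
Lemma modular_diff_coercive c0 C1 : 0 < c0 -> 0 <= C1 ->
  exists K, forall u r, 0 <= r -> bounded_measurable Om u ->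
    (forall x, Om x -> `|u x| <= C1 * r) -> c0 * r <= \int[mu]_(x in Om) `|u x| ->
    r - K <= J u.
Proof.
move=> c00 C10; have A0 : 0 <= 2 / c0 by rewrite divr_ge0// ltW.
have C11 : 0 < C1 + 1 by exact: ltr_wpDl.
have e0 : 0 < (C1 + 1)^-1 by rewrite invr_gt0.
have [M M0 tailM] := psi_plus_tail_small (2 / c0) _ e0.
have [K JK] := modular_diff_lower _ _ A0 M0.
exists K => u r r0 bu uC cu; apply: le_trans (JK _ _ bu uC).
have h1 : 2 * r <= 2 / c0 * \int[mu]_(x in Om) `|u x|.
  apply: (@le_trans _ _ (2 / c0 * (c0 * r))); last exact: ler_wpM2l.
  by rewrite mulrA divfK// gt_eqF.
set I := \int[mu]_(x in Om) (if _ then _ else _) in tailM *.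
have : C1 * r * I <= C1 * r * (C1 + 1)^-1 by rewrite ler_wpM2l// mulr_ge0.
have : C1 * r * (C1 + 1)^-1 <= r by rewrite ler_pdivrMr// mulrC ler_wpM2l// lerDl.
by lra.
Qed.

End best_approximation.

(** * Existence of a minimizer *)

Lemma coord_le_norm {R : realType} {N : nat} (c : 'rV[R]_N) i : `|c ord0 i| <= `|c|.
Proof.
by rewrite [leRHS]/Num.norm /= mx_normrE; apply/bigmax_geP; right => /=; exists (ord0, i).
Qed.

Section lincomb_theory.
Context {T : Type} {R : realType} {N : nat} (e : 'I_N -> T -> R).
Implicit Types c : 'rV[R]_N.

Lemma lincombB c c' x : lincomb e (c - c') x = lincomb e c x - lincomb e c' x.
Proof. by rewrite /lincomb -sumrB; apply: eq_bigr => i _; rewrite !mxE mulrBl. Qed.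

Lemma lincombZ a c x : lincomb e (a *: c) x = a * lincomb e c x.
Proof. by rewrite /lincomb mulr_sumr; apply: eq_bigr => i _; rewrite mxE mulrA. Qed.

End lincomb_theory.

Lemma lincomb_bounded {d} {T : measurableType d} {R : realType} {D : set T} {N}
    {e : 'I_N -> T -> R} :
  (forall i, bounded_measurable D (e i)) ->
  exists2 C, 0 <= C & forall c x, D x -> `|lincomb e c x| <= C * `|c|.
Proof.
move=> be; have /choice[C eC] : forall i, exists C, forall x, D x -> `|e i x| <= C.
  by move=> i; case: (be i).
exists (\sum_i `|C i|); first exact: sumr_ge0.
move=> c x Dx; rewrite (le_trans (ler_norm_sum _ _ _))// mulr_suml.
apply: ler_sum => i _; rewrite normrM mulrC ler_pM ?coord_le_norm//.
by rewrite (le_trans (eC _ _ Dx))// ler_norm.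
Qed.

Lemma bounded_measurable_lincomb {d} {T : measurableType d} {R : realType} {D : set T} {N}
    {e : 'I_N -> T -> R} c :
  (forall i, bounded_measurable D (e i)) -> bounded_measurable D (lincomb e c).
Proof.
move=> be; split; last first.
  by have [C _ eC] := lincomb_bounded be; exists (C * `|c|) => x; exact: eC.
apply: (@measurable_sum _ _ _ _ _ _ (fun i x => c ord0 i * e i x)) => i.
by apply: measurable_funM => //; case: (be i).
Qed.

Section minimizer.
Context {d} {T : measurableType d} {R : realType} {mu : {measure set T -> \bar R}}.
Context {Om : set T}.
Hypothesis mOm : measurable Om.
Hypothesis muOm : (mu Om < +oo)%E.
Context {psi phi : R -> R}.
Hypothesis psiS : class_S psi.
Hypothesis phiE : forall s, 0 <= s ->
  phi s = \int[lebesgue_measure]_(r in `[0, s]) psi r.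
Hypothesis phiD : Delta2 phi.
Context {f : T -> R}.
Hypothesis mf : measurable_fun Om f.
Hypothesis fint : (\int[mu]_(x in Om) (psi_plus phi `|f x|)%:E < +oo)%E.

Local Notation p := (psi_plus phi).
Local Notation J := (modular_diff mu Om phi f).

Section finite_family.
Context {N : nat} {e : 'I_N -> T -> R}.
Hypothesis be : forall i, bounded_measurable Om (e i).
Implicit Types c : 'rV[R]_N.

Local Notation q c := (\int[mu]_(x in Om) `|lincomb e c x|).

Let bl c : bounded_measurable Om (lincomb e c). Proof. exact: bounded_measurable_lincomb. Qed.

Lemma continuous_modular_diff_lincomb : continuous (fun c => J (lincomb e c)).
Proof.
have [C C0 eC] := lincomb_bounded be.
(* [M] bounds the combinations for all coefficient vectors in the closed unit ball around [c]. *)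
apply: locally_lipschitz_continuous => c; pose M := C * (`|c| + 1).
have M0 : 0 <= M by rewrite mulr_ge0// addr_ge0.
exists (C * \int[mu]_(x in Om) p (`|f x| + M)).
  rewrite mulr_ge0// Rintegral_ge0// => x _.
  by apply: (psi_plus_ge0 psiS phiE); exact: addr_ge0.
move=> c' cc'; rewrite mulrAC.
apply: (modular_diff_lipschitz mOm muOm psiS phiE phiD mf fint) => // x Omx.
- by rewrite (le_trans (eC _ _ Omx))// ler_wpM2l// lerDl.
- rewrite (le_trans (eC _ _ Omx))// ler_wpM2l//.
  by rewrite -(subKr c c') (le_trans (ler_normB _ _))// lerD2l.
- by rewrite -lincombB eC.
Qed.

Lemma continuous_norm1_lincomb : continuous (fun c => q c).
Proof.
have [C C0 eC] := lincomb_bounded be.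
have iq c := integrable_norm_bounded mOm muOm _ (bl c).
apply: locally_lipschitz_continuous => c; exists (C * fine (mu Om)).
  by rewrite mulr_ge0// fine_ge0.
move=> c' _; rewrite -RintegralB// mulrAC -Rintegral_cst//.
have iB : mu.-integrable Om (EFin \o (fun x => `|lincomb e c x| - `|lincomb e c' x|)).
  by rewrite (_ : _ \o _ = (fun x => (`|lincomb e c x|)%:E - (`|lincomb e c' x|)%:E)%E);
    [exact: (integrableB mOm (iq c) (iq c'))|apply/funext].
rewrite (le_trans (le_normr_Rintegral _ _))//; apply: le_Rintegral => //.
- rewrite (_ : _ \o _ = abse \o (EFin \o (fun x => `|lincomb e c x| - `|lincomb e c' x|))).
    exact: integrable_abse.
  by apply/funext.
- by apply: (integrable_bounded mOm muOm (cst (C * `|c - c'|)) `|C * `|c - c'| |).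
- move=> x Omx; rewrite (le_trans (ler_dist_dist _ _))// -lincombB.
  exact: eC.
Qed.

Lemma norm1_lincombZ a c : q (a *: c) = `|a| * q c.
Proof.
rewrite -RintegralZl//; last exact: (integrable_norm_bounded mOm muOm).
by apply: eq_Rintegral => x _; rewrite lincombZ normrM.
Qed.

(** The seminorm [q] is continuous and positive on the compact unit sphere; its minimum there is
    [c0], and homogeneity extends the bound to all [c]. *)
Lemma norm1_lincomb_ge : (forall c, c != 0 -> q c != 0) ->
  exists2 c0, 0 < c0 & forall c, c0 * `|c| <= q c.
Proof.
move=> q0; pose S : set 'rV[R]_N := [set c | `|c| = 1].
have q_ge0 c : 0 <= q c by exact: Rintegral_ge0.
have qS c : c != 0 -> S (`|c|^-1 *: c).
  by move=> c0; rewrite /S/= normrZ ger0_norm ?invr_ge0// mulVf// normr_eq0.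
(* The sphere is empty when [N = 0]; then every [c] is zero and any constant works. *)
have [S0|nS] := pselect (S !=set0); last first.
  exists 1 => // c; have [->|c0] := eqVneq c 0; first by rewrite normr0 mulr0.
  by exfalso; apply: nS; exists (`|c|^-1 *: c); exact: qS.
have cS : compact S.
  apply: bounded_closed_compact.
    by exists 1; split; [exact: num_real|move=> M M1 c /= ->; exact: ltW].
  have -> : S = (fun c : 'rV[R]_N => `|c|) @^-1` [set (1 : R)] by [].
  by apply: closed_comp; [move=> c _; exact: norm_continuous|exact: closed_eq].
have [m mS mq] := @EVT_min_rV R N (fun c => q c) S S0 cS (continuous_subspaceT continuous_norm1_lincomb).
have {}mS : S m by rewrite inE in mS.
have m0 : m != 0.
  by apply/eqP => m0; move: mS; rewrite m0 /S/= normr0 => /eqP; rewrite eq_sym oner_eq0.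
exists (q m); first by rewrite lt_neqAle eq_sym q0// q_ge0.
move=> c; have [->|c0] := eqVneq c 0; first by rewrite normr0 mulr0.
have c_gt0 : 0 < `|c| by rewrite normr_gt0.
rewrite mulrC -ler_pdivlMl//.
have := mq (`|c|^-1 *: c); rewrite inE => /(_ (qS _ c0)).
by rewrite norm1_lincombZ ger0_norm ?invr_ge0.
Qed.

Lemma modular_diff_minimizer_free : (forall c, c != 0 -> q c != 0) ->
  exists c, forall c', J (lincomb e c) <= J (lincomb e c').
Proof.
move=> /norm1_lincomb_ge[c0 c00 qc]; have [C C0 eC] := lincomb_bounded be.
have [K JK] := modular_diff_coercive mOm muOm psiS phiE phiD mf fint _ _ c00 C0.
have Jc c : `|c| - K <= J (lincomb e c).
  by apply: JK => // x; exact: eC.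
(* Outside the ball of radius [r], coercivity already gives values above the one at 0, so a minimum
   over the ball is global. *)
pose r := `|K + J (lincomb e 0)|.
pose B : set 'rV[R]_N := [set c | `|c| <= r].
have B0 : B 0 by rewrite /B/= normr0 /r.
have cB : compact B.
  apply: bounded_closed_compact.
    by exists r; split; [exact: num_real|move=> M rM c /= cr; rewrite (le_trans cr)// ltW].
  have -> : B = (fun c : 'rV[R]_N => `|c|) @^-1` [set x : R | x <= r] by [].
  by apply: closed_comp; [move=> c _; exact: norm_continuous|exact: closed_le].
have [m mB mJ] := @EVT_min_rV R N (fun c => J (lincomb e c)) B (ex_intro _ _ B0) cB
  (continuous_subspaceT continuous_modular_diff_lincomb).
exists m => c; have [cr|rc] := leP `|c| r; first by apply: mJ; rewrite inE.
have := mJ 0; rewrite inE => /(_ B0) /le_trans; apply.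
apply: le_trans (Jc c); have := ler_norm (K + J (lincomb e 0)); rewrite -/r.
by lra.
Qed.

End finite_family.

(* If the family is linearly dependent modulo equality a.e. on [Om], one of its
   members can be dropped without changing the values taken by [J]; this avoids
   proving that zero sets of polynomials are null. *)
Lemma modular_diff_minimizer N (e : 'I_N -> T -> R) :
  (forall i, bounded_measurable Om (e i)) ->
  exists c, forall c', J (lincomb e c) <= J (lincomb e c').
Proof.
elim: N e => [|N IH] e be.
  by exists 0 => c'; rewrite [c']thinmx0.
have [[c [cn0 qc0]]|nf] := pselect (exists c : 'rV[R]_N.+1,
    c != 0 /\ \int[mu]_(x in Om) `|lincomb e c x| = 0); last first.
  apply: modular_diff_minimizer_free => // c cn0; apply/eqP => qc0.
  by apply: nf; exists c.
have /rV0Pn[i ci0] := cn0.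
have [m mJ] := IH (fun j => e (lift i j)) (fun j => be _).
pose ext (a : 'rV[R]_N) : 'rV[R]_N.+1 :=
  \row_j (if unlift i j is Some k then a ord0 k else 0).
have extE a : lincomb e (ext a) = lincomb (fun j => e (lift i j)) a.
  apply/funext => x; rewrite /lincomb (bigD1_ord i)//= mxE unlift_none mul0r add0r.
  by apply: eq_bigr => j _; rewrite mxE liftK.
exists (ext m) => c'; rewrite extE.
(* [a] is chosen to kill coordinate [i]; the subtracted combination is null in the integral norm, so
   [J] does not change. *)
pose a := c' ord0 i / c ord0 i; pose c'' := c' - a *: c.
have -> : J (lincomb e c') = J (lincomb e c'').
  apply: (modular_diff_ae mOm muOm psiS phiE phiD mf fint);
    [exact: bounded_measurable_lincomb..|].
  under eq_Rintegral do rewrite -lincombB /c'' subKr.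
  by rewrite norm1_lincombZ// qc0 mulr0.
have -> : c'' = ext (\row_j c'' ord0 (lift i j)).
  apply/rowP => j; rewrite [RHS]mxE; case: unliftP => [k ->|->]; first by rewrite [RHS]mxE.
  by rewrite !mxE /a divfK// subrr.
by rewrite extE.
Qed.

End minimizer.

(** * The variational inequality *)

Lemma normrD_ge0M {R : realDomainType} (a b : R) : 0 <= a * b -> `|a + b| = `|a| + `|b|.
Proof.
have [a0|a0|->] := ltrgt0P a; last by rewrite !add0r.
  by rewrite pmulr_rge0// => b0; rewrite !ger0_norm// addr_ge0// ltW.
rewrite nmulr_rge0// => b0; have ab0 : a + b <= 0 by lra.
by rewrite (ler0_norm b0) (ler0_norm ab0) opprD.
Qed.

Lemma normrD_le0M {R : realDomainType} (a b : R) : a * b <= 0 -> `|b| <= `|a| ->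
  `|a + b| = `|a| - `|b|.
Proof.
have [a0|a0|->] := ltrgt0P a; last first.
- by rewrite normr_le0 => _ /eqP ->; rewrite addr0 normr0 subr0.
- rewrite nmulr_rle0// => b0; rewrite (ger0_norm b0) => ba.
  by rewrite ler0_norm; lra.
- rewrite pmulr_rle0// => b0; rewrite (ler0_norm b0) opprK => ba.
  by rewrite ger0_norm//; lra.
Qed.

(* The right derivative at [t = 0] of [phi |a + t b|] is
   [gain phi a b - loss phi a b]. *)
Definition gain {R : realType} (phi : R -> R) (a b : R) : R :=
  if 0 < a * b then psi_plus phi `|a| * `|b| else 0.

Definition loss {R : realType} (phi : R -> R) (a b : R) : R :=
  if a * b < 0 then psi_minus phi `|a| * `|b| else 0.

Section optimality.
Context {d} {T : measurableType d} {R : realType} {mu : {measure set T -> \bar R}}.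
Context {Om : set T}.
Hypothesis mOm : measurable Om.
Hypothesis muOm : (mu Om < +oo)%E.
Context {psi phi : R -> R}.
Hypothesis psiS : class_S psi.
Hypothesis phiE : forall s, 0 <= s ->
  phi s = \int[lebesgue_measure]_(r in `[0, s]) psi r.
Hypothesis phiD : Delta2 phi.
Context {f : T -> R}.
Hypothesis mf : measurable_fun Om f.
Hypothesis fint : (\int[mu]_(x in Om) (psi_plus phi `|f x|)%:E < +oo)%E.

Local Notation p := (psi_plus phi).
Local Notation J := (modular_diff mu Om phi f).
Implicit Types (a b C D : R) (u v : T -> R) (x : T).

Let pge0 := psi_plus_ge0 psiS phiE.
Let pnd := psi_plus_nd psiS phiE.

(** For [a b >= 0] one has [|a + t b| = |a| + t |b|], giving right slopes at [|a|]; for [a b < 0]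
    and small [t] it is [|a| - t |b|], giving left slopes with a sign change. A sequence of steps is
    used to suit dominated convergence. *)
Lemma young_norm_dirderiv a b :
  (harmonic n)^-1 * (phi `|a + harmonic n * b| - phi `|a|) @[n --> \oo] -->
    gain phi a b - loss phi a b.
Proof.
have h0 n : 0 < @harmonic R n by rewrite /harmonic/=.
have [->|b0] := eqVneq b 0.
  rewrite /gain /loss mulr0 ltxx subr0.
  by under eq_fun do rewrite mulr0 addr0 subrr mulr0; exact: cvg_cst.
have bgt0 : 0 < `|b| by rewrite normr_gt0.
have hb : harmonic n * `|b| @[n --> \oo] --> (0 : R).
  by rewrite -[X in _ --> X](mul0r `|b|); apply: cvgMl; exact: cvg_harmonic.
have scale n : `|harmonic n * b| = harmonic n * `|b|.
  by rewrite normrM ger0_norm// ltW.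
have [ab|ab] := leP 0 (a * b).
  have -> : gain phi a b - loss phi a b = `|b| * p `|a|.
    rewrite /gain /loss [a * b < 0]ltNge ab/= subr0 lt_def ab andbT mulf_eq0 (negbTE b0) orbF.
    (* For [a = 0] the formula of [gain] returns 0, which agrees because [psi_plus phi 0 = 0]. *)
    have [->|_] := eqVneq a 0; last by rewrite mulrC.
    by rewrite normr0 (psi_plus0 psiS phiE) mulr0.
  have /cvg_at_rightP/(_ (fun n => harmonic n * `|b|)) :=
    psi_plus_cvg psiS phiE _ (normr_ge0 a).
  move=> H; have {}H := H (conj (fun n => mulr_gt0 (h0 n) bgt0) hb).
  have -> : (fun n => (harmonic n)^-1 * (phi `|a + harmonic n * b| - phi `|a|)) =
      (fun n => `|b| * ((harmonic n * `|b|)^-1 *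
        (phi (`|a| + harmonic n * `|b|) - phi `|a|))).
    apply/funext => n; rewrite normrD_ge0M ?scale; last first.
      by rewrite mulrCA mulr_ge0// ltW.
    by rewrite invfM mulrA mulrCA divff ?gt_eqF// mulr1.
  exact: cvgMr.
have a0 : 0 < `|a| by rewrite normr_gt0; apply: contraTneq ab => ->; rewrite mul0r ltxx.
have -> : gain phi a b - loss phi a b = - `|b| * psi_minus phi `|a|.
  by rewrite /gain /loss ab [0 < a * b]ltNge (ltW ab)/= sub0r mulNr mulrC.
have /cvg_at_leftP/(_ (fun n => - (harmonic n * `|b|))) := psi_minus_cvg psiS phiE _ a0.
have hbN : - (harmonic n * `|b|) @[n --> \oo] --> (0 : R).
  by rewrite -oppr0; exact: cvgN.
have hb0 n : - (harmonic n * `|b|) < 0 by rewrite oppr_lt0 mulr_gt0.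
move=> H; have {}H := H (conj hb0 hbN).
have {}H : - `|b| * ((- (harmonic n * `|b|))^-1 *
    (phi (`|a| - harmonic n * `|b|) - phi `|a|)) @[n --> \oo] -->
    - `|b| * psi_minus phi `|a|.
  by apply: cvgM H; exact: cvg_cst.
(* The two sequences agree only once [t |b| <= |a|], hence the explicit eventual argument. *)
apply/cvgrPdist_lt => eps eps0; move/cvgrPdist_lt: H => /(_ _ eps0) H.
near=> n.
suff <- : - `|b| * ((- (harmonic n * `|b|))^-1 *
    (phi (`|a| - harmonic n * `|b|) - phi `|a|)) =
  (harmonic n)^-1 * (phi `|a + harmonic n * b| - phi `|a|) by near: n.
have ba : harmonic n * `|b| <= `|a|.
  by near: n; apply: (cvgr_le _ hb).
rewrite normrD_le0M ?scale//; last first.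
  by rewrite mulrCA pmulr_rle0// ltW.
by rewrite invrN mulrA mulrNN invfM mulrCA divff ?gt_eqF// mulr1.
Unshelve. all: by end_near. Qed.

Lemma measurable_gain (D : set T) (g h : T -> R) : measurable D ->
  measurable_fun D g -> measurable_fun D h ->
  measurable_fun D (fun x => gain phi (g x) (h x)).
Proof.
move=> mD mg mh; apply: measurable_fun_if => //.
  by apply: measurable_fun_ltr => //; exact: measurable_funM.
apply: (@measurable_funS _ _ _ _ D) => //; apply: measurable_funM.
  exact: (measurable_psi_plus_norm psiS phiE).
exact: measurableT_comp.
Qed.

Lemma measurable_loss (D : set T) (g h : T -> R) : measurable D ->
  measurable_fun D g -> measurable_fun D h ->
  measurable_fun D (fun x => loss phi (g x) (h x)).
Proof.
move=> mD mg mh; apply: measurable_fun_if => //.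
  by apply: measurable_fun_ltr => //; exact: measurable_funM.
apply: (@measurable_funS _ _ _ _ D) => //; apply: measurable_funM.
  exact: (measurable_psi_minus_norm psiS phiE).
exact: measurableT_comp.
Qed.

Lemma gain_bounds a b : 0 <= gain phi a b <= p `|a| * `|b|.
Proof.
have pb : 0 <= p `|a| * `|b| by rewrite mulr_ge0 ?pge0.
by rewrite /gain; case: ifP; rewrite ?pb ?lexx.
Qed.

Lemma loss_bounds a b : 0 <= loss phi a b <= p `|a| * `|b|.
Proof.
have qb : 0 <= psi_minus phi `|a| * `|b|.
  by rewrite mulr_ge0 ?(psi_minus_ge0 psiS phiE).
have pb : 0 <= p `|a| * `|b| by rewrite mulr_ge0 ?pge0.
rewrite /loss; case: ifP; rewrite ?qb ?lexx ?pb// => _.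
by rewrite ler_wpM2r// (psi_minus_le_plus psiS phiE).
Qed.

Lemma psi_plus_residual_integrable u v : bounded_measurable Om u ->
  bounded_measurable Om v ->
  mu.-integrable Om (fun x => (p `|f x - u x| * `|v x|)%:E).
Proof.
move=> [mu_u [C uC]] [mu_v [D vD]].
apply: (@le_integrable _ _ _ _ _ mOm _ (fun x => `|D|%:E * (p (`|f x| + `|C|))%:E)%E).
- apply/measurable_EFinP; apply: measurable_funM; last exact: measurableT_comp.
  by apply: (measurable_psi_plus_norm psiS phiE); exact: measurable_funB.
- move=> x Omx; rewrite -EFinM lee_fin (le_trans _ (ler_norm _))//.
  rewrite normrM normr_id (ger0_norm (pge0 _ (normr_ge0 _))) mulrC.
  rewrite ler_pM ?pge0//.
    by rewrite (le_trans (vD _ Omx))// ler_norm.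
  apply: pnd => //; rewrite (le_trans (ler_normB _ _))// lerD2l.
  by rewrite (le_trans (uC _ Omx))// ler_norm.
- by apply: integrableZl => //; exact: (integrable_psi_plus_shift mOm muOm psiS phiE phiD mf fint).
Qed.

(** Minimality makes the integral of each difference quotient nonnegative. Replacing [u] by
    [u - t v] moves the residual [f - u] in direction [v], so the limit integrand is [gain - loss],
    whose integral splits since both are integrable. *)
Lemma le_integral_loss_gain u v : bounded_measurable Om u -> bounded_measurable Om v ->
  (forall t, J u <= J (fun x => u x - t * v x)) ->
  (\int[mu]_(x in Om) (loss phi (f x - u x) (v x))%:E <=
   \int[mu]_(x in Om) (gain phi (f x - u x) (v x))%:E)%E.
Proof.
move=> bu bv Jmin.
have [mu_u [C uC]] := bu; have [mu_v [D vD]] := bv.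
have mfu : measurable_fun Om (fun x => f x - u x) by exact: measurable_funB.
have but t : bounded_measurable Om (fun x => u x - t * v x).
  split; first by apply: measurable_funB => //; exact: measurable_funM.
  exists (C + `|t| * D) => x Omx; rewrite (le_trans (ler_normB _ _))// lerD ?uC//.
  by rewrite normrM ler_wpM2l// vD.
have ires := psi_plus_residual_integrable _ _ bu bv.
have ig : mu.-integrable Om (fun x => (gain phi (f x - u x) (v x))%:E).
  apply: le_integrable ires => //.
    by apply/measurable_EFinP; exact: measurable_gain.
  move=> x _; have /andP[g0 g1] := gain_bounds (f x - u x) (v x).
  by rewrite lee_fin ger0_norm// (le_trans g1)// ler_norm.
have il : mu.-integrable Om (fun x => (loss phi (f x - u x) (v x))%:E).
  apply: le_integrable ires => //.
    by apply/measurable_EFinP; exact: measurable_loss.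
  move=> x _; have /andP[g0 g1] := loss_bounds (f x - u x) (v x).
  by rewrite lee_fin ger0_norm// (le_trans g1)// ler_norm.
have h0 n : 0 < @harmonic R n by rewrite /harmonic/=.
have h1 n : @harmonic R n <= 1 by rewrite /harmonic/= invf_le1// ler1n.
pose g n x : R := (harmonic n)^-1 *
  (phi `|f x - (u x - harmonic n * v x)| - phi `|f x - u x|).
have ig0 n : mu.-integrable Om (fun x =>
    (phi `|f x - (u x - harmonic n * v x)| - phi `|f x - u x|)%:E).
  exact: (integrable_young_diff mOm muOm psiS phiE phiD mf fint).
have ign n : mu.-integrable Om (EFin \o g n).
  by rewrite (_ : _ \o _ = (fun x => (harmonic n)^-1%:E *
    (phi `|f x - (u x - harmonic n * v x)| - phi `|f x - u x|)%:E)%E);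
    [exact: integrableZl|apply/funext].
have gint n : 0 <= \int[mu]_(x in Om) g n x.
  rewrite /g RintegralZl//; last exact: ig0.
  rewrite mulr_ge0 ?invr_ge0 ?(ltW (h0 n))//.
  by rewrite -(modular_diffB mOm muOm psiS phiE phiD mf fint _ _ (but _) bu) subr_ge0.
have D0 : 0 <= `|C| + `|D| by rewrite addr_ge0.
have idom : mu.-integrable Om (fun x => (`|D|%:E * (p (`|f x| + (`|C| + `|D|)))%:E)%E).
  apply: integrableZl => //.
  exact: (integrable_psi_plus_shift mOm muOm psiS phiE phiD mf fint).
have glim : {ae mu, forall x, Om x -> (fun n => (g n x)%:E) @ \oo -->
    (gain phi (f x - u x) (v x) - loss phi (f x - u x) (v x))%:E}.
  apply: aeW => x Omx; apply: cvg_EFin; first by apply: nearW.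
  rewrite /g; under eq_fun do rewrite opprB addrA addrAC.
  exact: young_norm_dirderiv.
have gdom : {ae mu, forall x n, Om x ->
    (`|(g n x)%:E| <= `|D|%:E * (p (`|f x| + (`|C| + `|D|)))%:E)%E}.
  apply: aeW => x n Omx; rewrite -EFinM lee_fin /g normrM.
  rewrite ger0_norm ?invr_ge0 ?(ltW (h0 n))// ler_pdivrMl// mulrA.
  apply: (young_diff_bound psiS phiE (fun x => u x - harmonic n * v x) u) => /=.
  - rewrite (le_trans (ler_normB _ _))// lerD//.
      by rewrite (le_trans (uC _ Omx))// ler_norm.
    rewrite normrM ger0_norm ?(ltW (h0 n))// -[leRHS]mul1r ler_pM ?(ltW (h0 n)) ?h1//.
    by rewrite (le_trans (vD _ Omx))// ler_norm.
  - by rewrite (le_trans (uC _ Omx))// (le_trans (ler_norm _))// lerDl.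
  - rewrite addrAC subrr add0r normrN normrM ger0_norm ?(ltW (h0 n))// ler_pM2l//.
    by rewrite (le_trans (vD _ Omx))// ler_norm.
have mgn n : measurable_fun Om (fun x => (g n x)%:E) by exact: measurable_int (ign n).
have mlim : measurable_fun Om (fun x =>
    (gain phi (f x - u x) (v x) - loss phi (f x - u x) (v x))%:E).
  by apply/measurable_EFinP/measurable_funB; [exact: measurable_gain|exact: measurable_loss].
have [_ _ cvgI] := dominated_convergence mOm mgn mlim glim idom gdom.
have : (0 <= \int[mu]_(x in Om)
    (gain phi (f x - u x) (v x) - loss phi (f x - u x) (v x))%:E)%E.
  apply: (cvge_to_ge cvgI); apply: nearW => n /=.
  rewrite -[X in (_ <= X)%E]fineK ?lee_fin; first exact: gint.
  exact: integrable_fin_num (ign n).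
under eq_integral do rewrite EFinB.
by rewrite integralB_EFin// sube_ge0// integrable_fin_num// orbT.
Qed.

Lemma le_integral_young_loss_gain u Lambda S : bounded_measurable Om u ->
  (forall x, Om x -> `|u x| <= S) ->
  Delta2_constant p Lambda ->
  (\int[mu]_(x in Om) (loss phi (f x - u x) (u x))%:E <=
   \int[mu]_(x in Om) (gain phi (f x - u x) (u x))%:E)%E ->
  (\int[mu]_(x in Om) (phi `|u x|)%:E <=
   (2 * Lambda * S)%:E * \int[mu]_(x in Om) (p `|f x|)%:E)%E.
Proof.
move=> bu uS [L0 pL] lg.
(* A point of [Om] is needed to infer [0 <= S]. *)
have [Om0|/set0P[y Omy]] := eqVneq Om set0; first by rewrite Om0 !integral_set0 mule0.
have S0 : 0 <= S by exact: le_trans (uS _ Omy).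
have [mu_u _] := bu.
have mfu : measurable_fun Om (fun x => f x - u x) by exact: measurable_funB.
have mloss := measurable_loss _ _ _ mOm mfu mu_u.
have mgain := measurable_gain _ _ _ mOm mfu mu_u.
have mp : measurable_fun Om (fun x => p `|f x|) by exact: (measurable_psi_plus_norm psiS phiE).
have loss0 x := proj1 (andP (loss_bounds (f x - u x) (u x))).
have gain0 x := proj1 (andP (gain_bounds (f x - u x) (u x))).
have p0 x : 0 <= p `|f x| by exact: pge0.
(* Where the gain is nonzero, [f - u] and [u] have the same sign, so [|f| = |f - u| + |u|] and
   [p |f - u| <= p |f|]. *)
have gainS : (\int[mu]_(x in Om) (gain phi (f x - u x) (u x))%:E <=
    S%:E * \int[mu]_(x in Om) (p `|f x|)%:E)%E.
  rewrite -ge0_integralZl_EFin//; [|by move=> x _; rewrite lee_fin|exact/measurable_EFinP].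
  apply: ge0_le_integral => //.
  - by move=> x _; rewrite lee_fin.
  - exact/measurable_EFinP.
  - by apply: emeasurable_funM => //; exact/measurable_EFinP.
  move=> x Omx; rewrite -EFinM lee_fin /gain; case: ifP => fu; last by rewrite mulr_ge0.
  rewrite mulrC ler_pM ?pge0// ?uS//; apply: pnd => //.
  by rewrite -[X in _ <= `|X|](subrK (u x)) (normrD_ge0M _ _ (ltW fu)) lerDl.
have LS : 0 <= Lambda * S by rewrite mulr_ge0// ltW.
(* Each summand contributes [Lambda * S] times the integral of [p |f|]: the first through loss, gain
   and [gainS], the second directly. Hence the factor 2. *)
apply: (@le_trans _ _ (\int[mu]_(x in Om) (Lambda%:E * (loss phi (f x - u x) (u x))%:E +
    (Lambda * S)%:E * (p `|f x|)%:E))%E).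
  apply: ge0_le_integral => //.
  - by move=> x _; rewrite lee_fin; exact: (young_ge0 psiS phiE).
  - by apply/measurable_EFinP; exact: (measurable_young_norm psiS phiE).
  - apply: emeasurable_funD; apply: emeasurable_funM => //; exact/measurable_EFinP.
  move=> x Omx; rewrite -!EFinM -EFinD lee_fin.
  have u0 := normr_ge0 (u x).
  have phiu : phi `|u x| <= `|u x| * p `|u x|.
    have := young_increment_le_psi_plus psiS phiE _ _ (lexx 0) u0.
    by rewrite (young0 phiE) !subr0.
  have [uf|fu] := leP `|u x| (2 * `|f x|).
    have pu : p `|u x| <= Lambda * p `|f x|.
      by apply: le_trans (pL _ (normr_ge0 _)); exact: pnd.
    have : `|u x| * p `|u x| <= S * (Lambda * p `|f x|).
      by apply: ler_pM => //; rewrite ?pge0 ?uS.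
    have : 0 <= Lambda * loss phi (f x - u x) (u x) by rewrite mulr_ge0// ltW.
    by lra.
  have pS : 0 <= Lambda * S * p `|f x| by exact: mulr_ge0.
  suff : `|u x| * p `|u x| <= Lambda * loss phi (f x - u x) (u x) by lra.
  (* The strict inequality is what allows passing from [psi_plus] at [|u| / 2] to [psi_minus] at
     [|f - u|]. *)
  have fu2 : `|u x| / 2 < `|f x - u x|.
    by have := lerB_dist (u x) (f x); rewrite [`|u x - _|]distrC; lra.
  have fu1 : (f x - u x) * u x < 0.
    have := ler_norm (f x); have := ler_norm (- f x); rewrite normrN.
    move: fu; have [ux|ux|->] := ltrgt0P (u x).
    - by rewrite pmulr_llt0//; lra.
    - by rewrite nmulr_llt0//; lra.
    - by have := normr_ge0 (f x); lra.
  rewrite /loss fu1 mulrA [leRHS]mulrC ler_wpM2l//.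
  have uE : `|u x| = 2 * (`|u x| / 2) by rewrite mulrCA divff ?mulr1.
  apply: (@le_trans _ _ (Lambda * p (`|u x| / 2))).
    by rewrite {1}uE pL// divr_ge0.
  rewrite ler_wpM2l ?(ltW L0)// (psi_plus_le_minus psiS phiE)// divr_ge0//.
rewrite ge0_integralD//; last 4 first.
- by move=> x _; rewrite -EFinM lee_fin mulr_ge0// ltW.
- by apply: emeasurable_funM => //; exact/measurable_EFinP.
- by move=> x _; rewrite -EFinM lee_fin mulr_ge0.
- by apply: emeasurable_funM => //; exact/measurable_EFinP.
rewrite !ge0_integralZl_EFin//; last 5 first.
- by move=> x _; rewrite lee_fin.
- exact/measurable_EFinP.
- by move=> x _; rewrite lee_fin.
- exact/measurable_EFinP.
- exact: ltW.
rewrite (_ : 2 * Lambda * S = Lambda * S + Lambda * S); last ring.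
rewrite EFinD ge0_muleDl ?lee_fin// leeD2r// EFinM -muleA.
by rewrite lee_wpmul2l ?lee_fin ?(ltW L0)// (le_trans lg).
Qed.

End optimality.

(** * Sums of integrals over sign regions as integrals of [loss] and [gain] *)

Lemma integral_split_pieces {d} {T : measurableType d} {R : realType}
    (mu : {measure set T -> \bar R}) (D A B : set T) (h k : T -> R) :
  measurable D -> measurable (D `&` A) -> measurable (D `&` B) -> [disjoint A & B] ->
  measurable_fun D h -> (forall x, 0 <= h x) ->
  (forall x, D x -> k x = if x \in A `|` B then h x else 0) ->
  (\int[mu]_(x in D `&` A) (h x)%:E + \int[mu]_(x in D `&` B) (h x)%:E =
   \int[mu]_(x in D) (k x)%:E)%E.
Proof.
move=> mD mA mB AB mh h0 kE; rewrite -ge0_integral_setU//; last 3 first.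
- apply/measurable_EFinP; apply: (measurable_funS mD) => //.
  by rewrite -setIUr; exact: subIsetl.
- by move=> x _; rewrite lee_fin.
- apply/disj_setPS => x [[_ Ax] [_ Bx]].
  by move/disj_setPS: AB; exact.
rewrite -setIUr integral_mkcondr; apply: eq_integral => x; rewrite inE => Dx.
by rewrite patchE kE//; case: ifP.
Qed.

Section integral_pieces.
Context {d} {T : measurableType d} {R : realType} {mu : {measure set T -> \bar R}}.
Context {D : set T}.
Hypothesis mD : measurable D.
Context {psi phi : R -> R}.
Hypothesis psiS : class_S psi.
Hypothesis phiE : forall s, 0 <= s ->
  phi s = \int[lebesgue_measure]_(r in `[0, s]) psi r.
Context {f u v : T -> R}.
Hypotheses (mf : measurable_fun D f) (mu_u : measurable_fun D u) (mu_v : measurable_fun D v).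

Let measurable_lt (g1 h1 g2 h2 : T -> R) :
  measurable_fun D g1 -> measurable_fun D h1 -> measurable_fun D g2 -> measurable_fun D h2 ->
  measurable (D `&` ([set x | g1 x < h1 x] `&` [set x | g2 x < h2 x])).
Proof.
move=> mg1 mh1 mg2 mh2; rewrite setIIr; apply: measurableI.
  by apply: (@measurable_fun_ltr _ _ _ _ _ _ mg1 mh1 mD [set true]) => //.
by apply: (@measurable_fun_ltr _ _ _ _ _ _ mg2 mh2 mD [set true]) => //.
Qed.

Lemma integral_lossE :
  (\int[mu]_(x in D `&` ([set x | (f x > u x)%R] `&` [set x | (v x < 0)%R]))
     (psi_minus phi `|f x - u x| * `|v x|)%:E
 + \int[mu]_(x in D `&` ([set x | (f x < u x)%R] `&` [set x | (v x > 0)%R]))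
     (psi_minus phi `|f x - u x| * `|v x|)%:E
 = \int[mu]_(x in D) (loss phi (f x - u x) (v x))%:E)%E.
Proof.
apply: integral_split_pieces => //; [exact: measurable_lt..| | | |].
- by apply/disj_setPS => x [[/= uf _] [/= fu _]]; have := lt_trans uf fu; rewrite ltxx.
- apply: measurable_funM; last exact: measurableT_comp.
  by apply: (measurable_psi_minus_norm psiS phiE); exact: measurable_funB.
- by move=> x; rewrite mulr_ge0 ?(psi_minus_ge0 psiS phiE).
move=> x _; rewrite /loss; congr (if _ then _ else _).
apply/idP/idP; rewrite inE/=.
  have [fu|fu|->] := ltrgtP (f x) (u x); last by rewrite subrr mul0r ltxx.
    by rewrite nmulr_rlt0 ?subr_lt0// => v0; right.
  by rewrite pmulr_rlt0 ?subr_gt0// => v0; left.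
by case=> -[fu v0]; [rewrite pmulr_rlt0 ?subr_gt0|rewrite nmulr_rlt0 ?subr_lt0].
Qed.

Lemma integral_gainE :
  (\int[mu]_(x in D `&` ([set x | (f x < u x)%R] `&` [set x | (v x < 0)%R]))
     (psi_plus phi `|f x - u x| * `|v x|)%:E
 + \int[mu]_(x in D `&` ([set x | (f x > u x)%R] `&` [set x | (v x > 0)%R]))
     (psi_plus phi `|f x - u x| * `|v x|)%:E
 = \int[mu]_(x in D) (gain phi (f x - u x) (v x))%:E)%E.
Proof.
apply: integral_split_pieces => //; [exact: measurable_lt..| | | |].
- by apply/disj_setPS => x [[/= uf _] [/= fu _]]; have := lt_trans uf fu; rewrite ltxx.
- apply: measurable_funM; last exact: measurableT_comp.
  by apply: (measurable_psi_plus_norm psiS phiE); exact: measurable_funB.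
- by move=> x; rewrite mulr_ge0 ?(psi_plus_ge0 psiS phiE).
move=> x _; rewrite /gain; congr (if _ then _ else _).
apply/idP/idP; rewrite inE/=.
  have [fu|fu|->] := ltrgtP (f x) (u x); last by rewrite subrr mul0r ltxx.
    by rewrite nmulr_rgt0 ?subr_lt0// => v0; left.
  by rewrite pmulr_rgt0 ?subr_gt0// => v0; right.
by case=> -[fu v0]; [rewrite nmulr_rgt0 ?subr_lt0|rewrite pmulr_rgt0 ?subr_gt0].
Qed.

End integral_pieces.

(** * Lebesgue measure on R^n *)

Section lebesgue_Rn_theory.
Context {R : realType} {n : nat}.
Local Notation Rn := 'rV[R]_n.+1.
Implicit Types (c : Rn * Rn) (i : 'I_n.+1) (a : R).

Let set_coord (x : Rn) i a : Rn := \row_j (if j == i then a else x ord0 j).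

Let clip_le c i a := (c.1, set_coord c.2 i (Num.min (c.2 ord0 i) a)).
Let clip_gt c i a := (set_coord c.1 i (Num.max (c.1 ord0 i) a), c.2).

Let box_clip_le c i a : box c `&` [set x | x ord0 i <= a] `<=` box (clip_le c i a).
Proof.
move=> x [xc /= xa] j; rewrite /= mxE; case: eqP => [->|_]; last exact: xc.
by have /andP[-> /= xr] := xc i; rewrite le_min xr.
Qed.

Let box_clip_gt c i a : box c `&` ~` [set x | x ord0 i <= a] `<=` box (clip_gt c i a).
Proof.
move=> x [xc /= /negP]; rewrite -ltNge => xa j; rewrite /= mxE.
case: eqP => [->|_]; last exact: xc.
by have /andP[xl ->] := xc i; rewrite gt_max xl xa.
Qed.

(** The hyperplane [x_i = a] changes only the factor of index [i], so this is additivity of the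
    length of an interval cut at [a], including the cases where a piece or the box itself is
    empty. *)
Let box_volume_clip c i a :
  box_volume (clip_le c i a) + box_volume (clip_gt c i a) = box_volume c.
Proof.
have volE c' : box_volume c' = Num.max 0 (c'.2 ord0 i - c'.1 ord0 i) *
    \prod_(j < n.+1 | j != i) Num.max 0 (c'.2 ord0 j - c'.1 ord0 j).
  by rewrite /box_volume (bigD1 i).
rewrite !volE /= !mxE eqxx.
rewrite (eq_bigr (fun j => Num.max 0 (c.2 ord0 j - c.1 ord0 j))); last first.
  by move=> j /negPf ji; rewrite mxE ji.
rewrite [X in _ + _ * X](eq_bigr (fun j => Num.max 0 (c.2 ord0 j - c.1 ord0 j))); last first.
  by move=> j /negPf ji; rewrite mxE ji.
rewrite -mulrDl; congr (_ * _).
set l := c.1 ord0 i; set r := c.2 ord0 i.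
rewrite ![Num.max 0 _]maxEle.
by case: (leP r a) => ra; case: (leP l a) => la; rewrite !subr_ge0;
  case: (leP l r) => lr; rewrite ?lr ?la; repeat (case: leP => ?); lra.
Qed.

(** Clipping the boxes of any cover of [X] yields covers of the two parts of [X] with the same total
    volume, which is the Caratheodory inequality. *)
Lemma measurable_half_space i a :
  measurable ([set x | x ord0 i <= a] : set (lebesgue_Rn_type R n)).
Proof.
apply: le_caratheodory_measurable => X; apply: le_ereal_inf_tmp => _ [c cX <-].
have V0 (c' : nat -> Rn * Rn) k : (0 <= (box_volume (c' k))%:E)%E.
  by rewrite lee_fin; apply: prodr_ge0 => j _; rewrite le_max lexx.
apply: (@le_trans _ _ (\sum_(k <oo) (box_volume (clip_le (c k) i a))%:E +
    \sum_(k <oo) (box_volume (clip_gt (c k) i a))%:E)%E).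
  apply: leeD; apply: ereal_inf_lbound.
  - exists (fun k => clip_le (c k) i a) => // x [/cX[k _ xk] xa].
    by exists k => //; exact: box_clip_le.
  - exists (fun k => clip_gt (c k) i a) => // x [/cX[k _ xk] xa].
    by exists k => //; exact: box_clip_gt.
rewrite -nneseriesD; last 2 first.
  by move=> k _ _; exact: (V0 (fun k => clip_le (c k) i a)).
  by move=> k _ _; exact: (V0 (fun k => clip_gt (c k) i a)).
rewrite le_eqVlt; apply/orP; left; apply/eqP; apply: eq_eseriesr => k _.
by rewrite -EFinD box_volume_clip.
Qed.

Lemma measurable_coord i :
  measurable_fun [set: lebesgue_Rn_type R n] (fun x => x ord0 i).
Proof.
apply: (measurability (@RGenOInfty.G R)) => [|_ [_ [a ->] <-]].
  exact: RGenOInfty.measurableE.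
rewrite setTI (_ : _ @^-1` _ = ~` [set x : lebesgue_Rn_type R n | x ord0 i <= a]).
  by apply: measurableC; exact: measurable_half_space.
by apply/seteqP; split => x /=; rewrite in_itv/= andbT ltNge => /negP.
Qed.

Lemma lebesgue_Rn_bounded (A : set Rn) : bounded_set A -> (lebesgue_Rn R n A < +oo)%E.
Proof.
move=> [M [_ /(_ (`|M| + 1))]]; rewrite ltr_pwDr ?ler_norm// => /(_ isT) AM.
(* Boxes are open on the left, so the lower corner lies strictly below [- r]; the rest of the cover
   consists of degenerate boxes of volume 0. *)
pose r := `|M| + 1; pose b : Rn * Rn := (const_mx (- r - 1), const_mx r).
pose c k : Rn * Rn := if k == 0%N then b else (0, 0).
apply: (@le_lt_trans _ _ (\sum_(k <oo) (box_volume (c k))%:E)%E).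
  apply: ereal_inf_lbound; exists c => // x /AM/= xr.
  exists 0%N => //= i; rewrite /c/= !mxE.
  have : `|x ord0 i| <= r.
    exact: le_trans (coord_le_norm x i) xr.
  by rewrite ler_norml => /andP[? ?]; apply/andP; split; lra.
rewrite (@nneseriesD1 _ _ 0%N)//; last first.
  by move=> k _; rewrite lee_fin; apply: prodr_ge0 => j _; rewrite le_max lexx.
rewrite eseries0 ?adde0 ?ltry// => k _ /= /negPf k0.
by rewrite /c k0 /box_volume big_ord_recl /= subrr maxxx mul0r.
Qed.

End lebesgue_Rn_theory.

(** * Polynomials *)

Section polynomial_family.
Context {R : realType} {n : nat} (m : nat).
Local Notation bmon := (bmultinom n.+1 m.+1).
Implicit Types (c : 'rV[R]_#|{: bmon}|).

(** Numbering the multi-indices of degree at most [m] by an ordinal turns coefficient families into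
    row vectors, as the minimization requires. *)
Definition monomial (j : 'I_#|{: bmon}|) (x : lebesgue_Rn_type R n) : R :=
  peval (mpolyX R (bmnm (enum_val j))) x.

Definition poly_of_coefs c : mpoly n.+1 R :=
  \sum_j c ord0 j *: mpolyX R (bmnm (enum_val j)).

Lemma peval_poly_of_coefs c x : peval (poly_of_coefs c) x = lincomb monomial c x.
Proof.
rewrite /peval /poly_of_coefs raddf_sum; apply: eq_bigr => j _ /=.
by rewrite mevalZ.
Qed.

Lemma poly_le_of_coefs c : poly_le m (poly_of_coefs c).
Proof.
rewrite /poly_le /poly_of_coefs; apply: (leq_trans (msize_sum _ _ _)).
apply/bigmax_leqP => j _; apply: (leq_trans (msizeZ_le _ _)).
by rewrite msizeX; exact: bmdeg.
Qed.

Lemma poly_of_coefs_surj (P : mpoly n.+1 R) : poly_le m P -> exists c, P = poly_of_coefs c.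
Proof.
move=> /mpolywE PE; exists (\row_j mcoeff (bmnm (enum_val j)) P).
rewrite [LHS]PE (reindex_onto enum_val enum_rank)/=; last by move=> i _; exact: enum_rankK.
by apply: eq_big => j; rewrite ?enum_valK ?eqxx// mxE.
Qed.

Lemma bounded_measurable_monomial (D : set (lebesgue_Rn_type R n)) j :
  bounded_set (D : set 'rV[R]_n.+1) -> bounded_measurable D (monomial j).
Proof.
have monomialE x : monomial j x = \prod_i x ord0 i ^+ (bmnm (enum_val j)) i.
  by rewrite /monomial /peval mevalX.
move=> [M [_ /(_ (`|M| + 1))]]; rewrite ltr_pwDr ?ler_norm// => /(_ isT) DM.
split.
  rewrite (_ : monomial _ = (fun x => \prod_i x ord0 i ^+ (bmnm (enum_val j)) i)); last exact/funext.
  apply: measurable_prod => i _; apply: measurable_funX.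
  exact: measurable_funTS (measurable_coord i).
exists (\prod_i (`|M| + 1) ^+ (bmnm (enum_val j)) i) => x /DM/= xM.
rewrite monomialE normr_prod; apply: ler_prod => i _.
rewrite normr_ge0 normrX lerXn2r ?nnegrE ?addr_ge0//.
exact: le_trans (coord_le_norm _ _) xM.
Qed.

End polynomial_family.

(** The bound [C] guarantees that [sup] is a genuine supremum and not a default value. *)
Lemma sup_norm_ge {R : realType} {n : nat} (D : set 'rV[R]_n.+1) (P : mpoly n.+1 R) C x :
  (forall y, D y -> `|peval P y| <= C) -> D x -> `|peval P x| <= sup_norm D P.
Proof.
move=> PC Dx; apply: ub_le_sup; last by exists x.
by exists C => _ [y Dy <-]; exact: PC.
Qed.

(** * Minimization over coefficient vectors, applied to polynomials on [Omega] *)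

Theorem theorem3p4 (R : realType) (n m : nat)
    (Omega : set (lebesgue_Rn_type R n))
    (mOmega : measurable Omega)
    (bOmega : bounded_set (Omega : set 'rV[R]_n.+1))
    (phi : R -> R) (phiP : class_Phi phi)
    (f : lebesgue_Rn_type R n -> R) (fL : class_L (psi_plus phi) Omega f) :
  exists P : mpoly n.+1 R,
    [/\ poly_le m P,
        forall Q : mpoly n.+1 R, poly_le m Q ->
          (\int[lebesgue_Rn R n]_(x in Omega `&`
               ([set x | (f x > peval P x)%R] `&` [set x | (peval Q x < 0)%R]))
             (psi_minus phi `|f x - peval P x| * `|peval Q x|)%:E
         + \int[lebesgue_Rn R n]_(x in Omega `&`
               ([set x | (f x < peval P x)%R] `&` [set x | (peval Q x > 0)%R]))
             (psi_minus phi `|f x - peval P x| * `|peval Q x|)%:E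
         <= \int[lebesgue_Rn R n]_(x in Omega `&`
               ([set x | (f x < peval P x)%R] `&` [set x | (peval Q x < 0)%R]))
             (psi_plus phi `|f x - peval P x| * `|peval Q x|)%:E
         + \int[lebesgue_Rn R n]_(x in Omega `&`
               ([set x | (f x > peval P x)%R] `&` [set x | (peval Q x > 0)%R]))
             (psi_plus phi `|f x - peval P x| * `|peval Q x|)%:E)%E
      & forall Lambda : R, Delta2_constant (psi_plus phi) Lambda ->
          (\int[lebesgue_Rn R n]_(x in Omega) (phi `|peval P x|)%:E
           <= (5 * Lambda * sup_norm Omega P)%:E *
              \int[lebesgue_Rn R n]_(x in Omega) (psi_plus phi `|f x|)%:E)%E].
Proof.
have [[psi psiS phiE] phiD] := phiP; have [mf fint] := fL.
have muO : (lebesgue_Rn R n Omega < +oo)%E by exact: lebesgue_Rn_bounded.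
have be j : bounded_measurable Omega (@monomial R n m j).
  exact: bounded_measurable_monomial.
have [c cmin] := modular_diff_minimizer mOmega muO psiS phiE phiD mf fint _ _ be.
pose P := poly_of_coefs m c; exists P.
have PE : peval P = lincomb (monomial m) c.
  by apply/funext => x; exact: peval_poly_of_coefs.
have bP : bounded_measurable Omega (peval P).
  by rewrite PE; exact: bounded_measurable_lincomb.
have opt Q : poly_le m Q ->
    (\int[lebesgue_Rn R n]_(x in Omega) (loss phi (f x - peval P x) (peval Q x))%:E <=
     \int[lebesgue_Rn R n]_(x in Omega) (gain phi (f x - peval P x) (peval Q x))%:E)%E.
  move=> /poly_of_coefs_surj[c' ->].
  have QE : peval (poly_of_coefs m c') = lincomb (monomial m) c'.
    by apply/funext => x; exact: peval_poly_of_coefs.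
  rewrite PE QE; apply: (le_integral_loss_gain mOmega muO psiS phiE phiD mf fint);
    [exact: bounded_measurable_lincomb..|].
  (* The perturbed polynomial [P - t Q] is again a combination of the monomials, so [P] competes
     with it. *)
  move=> t; have := cmin (c - t *: c').
  congr (_ <= modular_diff _ _ _ _ _); apply/funext => x.
  by rewrite lincombB lincombZ.
split; first exact: poly_le_of_coefs.
- move=> Q Qm; have [mP _] := bP.
  have mQ : measurable_fun Omega (peval Q).
    have [c' ->] := poly_of_coefs_surj _ _ Qm.
    rewrite (_ : peval _ = lincomb (monomial m) c').
      by case: (bounded_measurable_lincomb c' be).
    by apply/funext => x; exact: peval_poly_of_coefs.
  by rewrite (integral_lossE mOmega psiS phiE)// (integral_gainE mOmega psiS phiE)// opt.
move=> Lambda LP; have [_ [C PC]] := bP.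
have PS x : Omega x -> `|peval P x| <= sup_norm Omega P by exact: sup_norm_ge PC.
have := le_integral_young_loss_gain mOmega psiS phiE mf _ _ _ bP PS LP
  (opt _ (poly_le_of_coefs _ _)).
move/le_trans; apply; apply: lee_wpmul2r.
  by apply: integral_ge0 => x _; rewrite lee_fin (psi_plus_ge0 psiS phiE).
(* Nonnegativity is needed to enlarge the factor 2 to 5; for empty [Omega] it comes from the
   convention that [sup] of the empty set is 0. *)
have norm_ge0 : 0 <= sup_norm Omega P.
  have [empty|/set0P[x Ox]] := eqVneq Omega set0.
    by rewrite /sup_norm empty image_set0 sup0.
  exact: le_trans (PS _ Ox).
rewrite lee_fin ler_wpM2r// ler_wpM2r ?ler_nat//.
by case: LP => /ltW.
Qed.
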